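(* Let $a,a'$ divide $d$, let $\chi$ be a smooth character of $D_a^\times$ and $\chi'$ a smooth character of $D_{a'}^\times$ such that $\pi=\mathrm{Ind}_{D_a^\times}^{D^\times}\chi$ and $\pi'=\mathrm{Ind}_{D_{a'}^\times}^{D^\times}\chi'$ are irreducible. Then for every $n\ge0$, \[\mathrm{Ext}^n_{D^\times}(\pi,\pi')\simeq\bigoplus_{\overline{s}\in D_{a'}^\times\backslash D^\times/D_a^\times}\mathrm{Ext}^n_{D^\times_{\mathrm{lcm}(a,a')}}\left(\mathbf{1},\left(\mathrm{Res}^{D_{a'}^\times}_{D^\times_{\mathrm{lcm}(a,a')}}\chi'\right)\otimes(\chi^s)^\ast\right),\] where $s$ is a representative of the double coset $\overline{s}$ and $\chi^s$ is the character of $D^\times_{\mathrm{lcm}(a,a')}$ given by $\chi^s(x)=\chi(s^{-1}xs)$.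
   Context: $F$ is a non-Archimedean local field of residue characteristic $p$ (a finite extension of $\mathbb{Q}_p$ or of $\mathbb{F}_p((t))$), $D$ a central division algebra over $F$ of degree $d>1$ with ring of integers $\mathcal{O}_D$ and a uniformizer $\varpi_D$ with $\varpi_D^d$ a uniformizer of $F$. For $a\mid d$, $D_a^\times:=F^\times\mathcal{O}_D^\times\langle\varpi_D^a\rangle$ (a normal finite-index subgroup of $D^\times$). All representations are smooth over $\overline{\mathbb{F}}_p$; $\mathrm{Ext}^n$ denotes derived functors of $\mathrm{Hom}$ in the category of smooth representations; $\mathbf{1}$ is the trivial character and $(\cdot)^\ast$ the dual character. Standing assumption: $p>de+1$ in the $p$-adic case ($e$ the ramification index of $F/\mathbb{Q}_p$), and $\gcd(p,d)=1$ in the function field case. *)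

(* Defs.v *)
From HB Require Import structures.
From mathcomp Require Import all_boot all_order all_algebra all_field.
From mathcomp Require Import all_classical.
From mathcomp Require Import topology.

Set Implicit Arguments.
Unset Strict Implicit.
Unset Printing Implicit Defensive.

Import Order.TTheory GRing.Theory Num.Theory.

Local Open Scope classical_set_scope.
Local Open Scope ring_scope.

Record submod (k : fieldType) (U : lmodType k) := Submod {
  submod_set :> U -> Prop;
  submod0 : submod_set 0;
  submodZD : forall (a : k) (x y : U),
    submod_set x -> submod_set y -> submod_set (a *: x + y) }.

Lemma submodD (k : fieldType) (U : lmodType k) (S : submod U) x y :
  S x -> S y -> S (x + y).
Proof. by move=> Sx Sy; rewrite -[x]scale1r; exact: submodZD. Qed.

Lemma submodZ (k : fieldType) (U : lmodType k) (S : submod U) a x :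
  S x -> S (a *: x).
Proof. by move=> Sx; rewrite -[_ *: _]addr0; apply: submodZD => //; exact: submod0. Qed.

Lemma submodN (k : fieldType) (U : lmodType k) (S : submod U) x : S x -> S (- x).
Proof. by rewrite -scaleN1r; exact: submodZ. Qed.

Lemma submodB (k : fieldType) (U : lmodType k) (S : submod U) x y :
  S x -> S y -> S (x - y).
Proof. by move=> Sx Sy; apply: submodD => //; exact: submodN. Qed.

Record submod_type (k : fieldType) (U : lmodType k) (S : submod U) := SubmodElt {
  submod_val :> U;
  submod_valP : submod_val \in (submod_set S : set U) }.

Section SubmodType.
Variables (k : fieldType) (U : lmodType k) (S : submod U).

HB.instance Definition _ := [isSub for @submod_val k U S].
HB.instance Definition _ := [Choice of submod_type S by <:].

Fact submod_closed_mem : subsemimod_closed (mem (submod_set S : set U)).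
Proof.
split; first split.
- by apply/mem_set; exact: submod0.
- by move=> x y /set_mem Sx /set_mem Sy; apply/mem_set; exact: submodD.
- by move=> a x /set_mem Sx; apply/mem_set; exact: submodZ.
Qed.

HB.instance Definition _ :=
  GRing.SubChoice_isSubLmodule.Build k U _ (submod_type S) submod_closed_mem.

Definition to_submod (x : U) (Sx : S x) : submod_type S := SubmodElt (mem_set Sx).

End SubmodType.

(* The elements of the quotient U / B are the cosets x + B. *)
Record quotmod (k : fieldType) (U : lmodType k) (B : submod U) := Quotmod {
  quotmod_coset : set U;
  quotmod_cosetP : exists x : U, quotmod_coset = [set y | B (y - x)] }.

Section Quotmod.
Variables (k : fieldType) (U : lmodType k) (B : submod U).

HB.instance Definition _ := gen_eqMixin (quotmod B).
HB.instance Definition _ := gen_choiceMixin (quotmod B).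

Definition qpi (x : U) : quotmod B :=
  @Quotmod k U B [set y | B (y - x)] (ex_intro _ x erefl).

Definition qrepr (q : quotmod B) : U := projT1 (cid (quotmod_cosetP q)).

Lemma quotmod_eq (q r : quotmod B) : quotmod_coset q = quotmod_coset r -> q = r.
Proof.
by case: q r => [C hC] [C' hC'] /= E; subst C'; congr Quotmod; exact: Prop_irrelevance.
Qed.

Lemma qreprK (q : quotmod B) : qpi (qrepr q) = q.
Proof. by apply: quotmod_eq; rewrite /qrepr; case: cid. Qed.

Lemma qpi_eq (x y : U) : qpi x = qpi y <-> B (x - y).
Proof.
split=> [/(congr1 (@quotmod_coset _ _ _)) /= /seteqP[/(_ x) /= h _]|Bxy].
  by apply: h; rewrite subrr; exact: submod0.
apply: quotmod_eq => /=; apply/seteqP; split=> z /= Bz.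
  by rewrite -(subrKA x); exact: submodD.
by rewrite -(subrKA y) -(opprB x); exact: submodB.
Qed.

Definition qzero : quotmod B := qpi 0.
Definition qopp (q : quotmod B) : quotmod B := qpi (- qrepr q).
Definition qadd (q r : quotmod B) : quotmod B := qpi (qrepr q + qrepr r).
Definition qscale (a : k) (q : quotmod B) : quotmod B := qpi (a *: qrepr q).

Lemma qrepr_pi x : B (qrepr (qpi x) - x).
Proof. by apply/qpi_eq; rewrite qreprK. Qed.

Lemma qaddE x y : qadd (qpi x) (qpi y) = qpi (x + y).
Proof.
apply/qpi_eq; rewrite opprD addrACA.
by apply: submodD; exact: qrepr_pi.
Qed.

Lemma qoppE x : qopp (qpi x) = qpi (- x).
Proof. by apply/qpi_eq; rewrite -opprD; apply: submodN; exact: qrepr_pi. Qed.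

Lemma qscaleE a x : qscale a (qpi x) = qpi (a *: x).
Proof. by apply/qpi_eq; rewrite -scalerBr; apply: submodZ; exact: qrepr_pi. Qed.

Lemma qpiP (q : quotmod B) : exists x, q = qpi x.
Proof. by exists (qrepr q); rewrite qreprK. Qed.

Fact qaddA : associative qadd.
Proof.
move=> p q r; case: (qpiP p) (qpiP q) (qpiP r) => [x ->] [y ->] [z ->].
by rewrite !qaddE addrA.
Qed.
Fact qaddC : commutative qadd.
Proof.
by move=> p q; case: (qpiP p) (qpiP q) => [x ->] [y ->]; rewrite !qaddE addrC.
Qed.
Fact qadd0 : left_id qzero qadd.
Proof. by move=> p; case: (qpiP p) => [x ->]; rewrite qaddE add0r. Qed.
Fact qaddN : left_inverse qzero qopp qadd.
Proof. by move=> p; case: (qpiP p) => [x ->]; rewrite qoppE qaddE addNr. Qed.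

HB.instance Definition _ :=
  GRing.isZmodule.Build (quotmod B) qaddA qaddC qadd0 qaddN.

Fact qscaleA a b q : qscale a (qscale b q) = qscale (a * b) q.
Proof. by case: (qpiP q) => [x ->]; rewrite !qscaleE scalerA. Qed.
Fact qscale1 : left_id 1 qscale.
Proof. by move=> q; case: (qpiP q) => [x ->]; rewrite !qscaleE scale1r. Qed.
Fact qscaleDr : right_distributive qscale +%R.
Proof.
move=> a p q; case: (qpiP p) (qpiP q) => [x ->] [y ->].
by rewrite /GRing.add /= !(qaddE, qscaleE) scalerDr.
Qed.
Fact qscaleDl q : {morph qscale^~ q : a b / a + b}.
Proof.
move=> a b; case: (qpiP q) => [x ->].
by rewrite /= !qscaleE scalerDl [in RHS]/GRing.add /= qaddE.
Qed.

HB.instance Definition _ :=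
  GRing.Zmodule_isLmodule.Build k (quotmod B) qscaleA qscale1 qscaleDr qscaleDl.

Fact qpi_linear : linear qpi.
Proof.
move=> a x y; rewrite /GRing.scale /= [in RHS]/GRing.add /=.
by rewrite qscaleE qaddE.
Qed.

HB.instance Definition _ := GRing.isLinear.Build k U (quotmod B) *:%R qpi qpi_linear.

Lemma qpi_eq0 x : qpi x = 0 <-> B x.
Proof. by rewrite -[X in B X]subr0; exact: qpi_eq. Qed.

End Quotmod.

Record dsum (k : fieldType) (X : Type) (M : X -> lmodType k) := Dsum {
  dsum_fun :> forall x, M x;
  dsum_finite : finite_set [set x | dsum_fun x != 0] }.

Section Dsum.
Variables (k : fieldType) (X : Type) (M : X -> lmodType k).
Local Notation dsum := (dsum M).

HB.instance Definition _ := gen_eqMixin dsum.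
HB.instance Definition _ := gen_choiceMixin dsum.

Lemma dsum_eq (f g : dsum) : (forall x, f x = g x) -> f = g.
Proof.
case: f g => [f hf] [g hg] /= fg; have E : f = g by exact: functional_extensionality_dep.
by subst g; congr Dsum; exact: Prop_irrelevance.
Qed.

Fact dsum_finite0 : finite_set [set x | (0 : M x) != 0].
Proof. by apply: (sub_finite_set _ (finite_set0 X)) => x /=; rewrite eqxx. Qed.
Fact dsum_finiteN (f : dsum) : finite_set [set x | - f x != 0].
Proof. by apply: (sub_finite_set _ (dsum_finite f)) => x /=; rewrite oppr_eq0. Qed.
Fact dsum_finiteD (f g : dsum) : finite_set [set x | f x + g x != 0].
Proof.
have h : finite_set ([set x | f x != 0] `|` [set x | g x != 0]).
  by rewrite finite_setU; split; exact: dsum_finite.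
apply: sub_finite_set h => x /= h.
case: (eqVneq (f x) 0) => [f0|]; [right|by left].
by move: h; rewrite f0 add0r.
Qed.
Fact dsum_finiteZ a (f : dsum) : finite_set [set x | a *: f x != 0].
Proof.
apply: (sub_finite_set _ (dsum_finite f)) => x /=.
by rewrite scaler_eq0 negb_or => /andP[].
Qed.

Definition dsum0 : dsum := Dsum dsum_finite0.
Definition dsumN (f : dsum) : dsum := Dsum (dsum_finiteN f).
Definition dsumD (f g : dsum) : dsum := Dsum (dsum_finiteD f g).
Definition dsumZ a (f : dsum) : dsum := Dsum (dsum_finiteZ a f).

Fact dsumA : associative dsumD.
Proof. by move=> f g h; apply: dsum_eq => x /=; rewrite addrA. Qed.
Fact dsumC : commutative dsumD.
Proof. by move=> f g; apply: dsum_eq => x /=; rewrite addrC. Qed.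
Fact dsum0D : left_id dsum0 dsumD.
Proof. by move=> f; apply: dsum_eq => x /=; rewrite add0r. Qed.
Fact dsumND : left_inverse dsum0 dsumN dsumD.
Proof. by move=> f; apply: dsum_eq => x /=; rewrite addNr. Qed.

HB.instance Definition _ := GRing.isZmodule.Build dsum dsumA dsumC dsum0D dsumND.

Fact dsumZA a b f : dsumZ a (dsumZ b f) = dsumZ (a * b) f.
Proof. by apply: dsum_eq => x /=; rewrite scalerA. Qed.
Fact dsumZ1 : left_id 1 dsumZ.
Proof. by move=> f; apply: dsum_eq => x /=; rewrite scale1r. Qed.
Fact dsumZDr : right_distributive dsumZ +%R.
Proof. by move=> a f g; apply: dsum_eq => x /=; rewrite scalerDr. Qed.
Fact dsumZDl f : {morph dsumZ^~ f : a b / a + b}.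
Proof. by move=> a b; apply: dsum_eq => x /=; rewrite scalerDl. Qed.

HB.instance Definition _ :=
  GRing.Zmodule_isLmodule.Build k dsum dsumZA dsumZ1 dsumZDr dsumZDl.

End Dsum.

Definition lmod_iso (k : fieldType) (A B : lmodType k) : Prop :=
  exists f : {linear A -> B}, bijective f.

HB.mixin Record isTopGroup G & Group G & Topological G := {
  mulg_continuous : continuous (fun xy : G * G => (xy.1 * xy.2)%g);
  invg_continuous : continuous (fun x : G => x^-1%g) }.

#[short(type="topGroupType")]
HB.structure Definition TopGroup := { G of Group G & Topological G & isTopGroup G }.

Record subgroup (G : groupType) := Subgroup {
  subgroup_set :> G -> Prop;
  subgroup1 : subgroup_set 1%g;
  subgroupM : forall x y, subgroup_set x -> subgroup_set y -> subgroup_set (x * y)%g;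
  subgroupV : forall x, subgroup_set x -> subgroup_set x^-1%g }.

Section Subgroups.
Variable G : groupType.
Local Open Scope group_scope.

Definition whole_group : subgroup G :=
  @Subgroup G setT I (fun _ _ _ _ => I) (fun _ _ => I).

Definition triv_group : subgroup G.
Proof.
refine (@Subgroup G [set 1] erefl _ _).
- by move=> _ _ -> ->; rewrite mulg1.
- by move=> _ ->; rewrite invg1.
Defined.

(* The subgroup s H s^-1; in MathComp, x ^ s is s^-1 * x * s. *)
Definition conj_group (s : G) (H : subgroup G) : subgroup G.
Proof.
refine (@Subgroup G [set x | H (x ^ s)] _ _ _).
- by rewrite /= conj1g; exact: subgroup1.
- by move=> x y Hx Hy; rewrite /= conjMg; exact: subgroupM.
- by move=> x Hx; rewrite /= conjVg; exact: subgroupV.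
Defined.

Definition gen_group (A : set G) : subgroup G.
Proof.
refine (@Subgroup G [set x | forall H : subgroup G, (forall a, A a -> H a) -> H x] _ _ _).
- by move=> H _; exact: subgroup1.
- by move=> x y hx hy H AH; apply: subgroupM; [exact: hx|exact: hy].
- by move=> x hx H AH; apply: subgroupV; exact: hx.
Defined.

Definition dcoset (K H : subgroup G) (s : G) : set G :=
  [set g | exists x y, [/\ K x, H y & g = x * s * y]].

(* The set K \ G / H of double cosets K s H. *)
Definition dcosets (K H : subgroup G) : Type :=
  {C : set G | exists s, C = dcoset K H s}.

End Subgroups.
Arguments whole_group {G}.
Arguments triv_group {G}.

Definition open_in (G : topGroupType) (L : subgroup G) (A : set G) : Prop :=
  exists2 U : set G, open U & A `&` subgroup_set L = U `&` subgroup_set L.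

Section OpenIn.
Variables (G : topGroupType) (L : subgroup G).
Local Open Scope group_scope.

Lemma mulg_continuousl (s : G) : continuous (fun x : G => s * x).
Proof.
move=> x; apply: (@continuous_comp _ _ _ (fun x => (s, x)) (fun xy : G * G => xy.1 * xy.2)).
  by apply: cvg_pair => /=; [exact: cvg_cst|exact: cvg_id].
exact: mulg_continuous.
Qed.

Lemma mulg_continuousr (s : G) : continuous (fun x : G => x * s).
Proof.
move=> x; apply: (@continuous_comp _ _ _ (fun x => (x, s)) (fun xy : G * G => xy.1 * xy.2)).
  by apply: cvg_pair => /=; [exact: cvg_id|exact: cvg_cst].
exact: mulg_continuous.
Qed.

Lemma conjg_continuous (s : G) : continuous (fun x : G => x ^ s).
Proof.
move=> x; apply: (@continuous_comp _ _ _ (fun x => x * s) (fun x => s^-1 * x)).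
  exact: mulg_continuousr.
exact: mulg_continuousl.
Qed.

Lemma open_in_nbhs (A : set G) : open_in L A -> A 1 ->
  exists U : set G, [/\ open U, U 1 & U `&` subgroup_set L `<=` A].
Proof.
case=> U oU AU A1; exists U; split=> //.
  by have [] : (U `&` subgroup_set L) 1 by rewrite -AU; split => //; exact: subgroup1.
by rewrite -AU; exact: subIsetl.
Qed.

Lemma open_in_mulclosed (A U : set G) : open U -> U 1 -> U `&` subgroup_set L `<=` A ->
  (forall x y, L x -> L y -> A x -> A y -> A (x * y)) -> open_in L A.
Proof.
move=> oU U1 UA AM.
exists (\bigcup_(g in A `&` subgroup_set L) ((fun x => g^-1 * x) @^-1` U)).
  apply: bigcup_open => g _; apply: open_comp => // x _.
  exact: mulg_continuousl.
apply/seteqP; split=> x [].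
  by move=> Ax Lx; split=> //; exists x => //=; rewrite mulVg.
case=> g [Ag Lg] /= Ux Lx; split=> //.
have Lgx : L (g^-1 * x) by apply: subgroupM => //; exact: subgroupV.
by rewrite -[x](mulVKg g); apply: AM => //; exact: UA.
Qed.

End OpenIn.

(* A smooth k-linear representation of a subgroup H of G.  The action is a
   function of all of G, but only its values on H are meaningful. *)
Record smoothRep (k : fieldType) (G : topGroupType) (H : subgroup G) := SmoothRep {
  rep_mod :> lmodType k;
  ract : G -> rep_mod -> rep_mod;
  ract_linear : forall g, H g -> linear (ract g);
  ract1 : forall v, ract 1%g v = v;
  ractM : forall g h v, H g -> H h -> ract (g * h)%g v = ract g (ract h v);
  ract_smooth : forall v, open_in H [set g | ract g v = v] }.
Arguments smoothRep k {G} H.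

Section Reps.
Variables (k : fieldType) (G : topGroupType) (H : subgroup G).
Local Notation rep := (smoothRep k H).

Definition is_rep_hom (V W : rep) (f : V -> W) : Prop :=
  linear f /\ forall h v, H h -> f (ract h v) = ract h (f v).

Definition irreducible_rep (V : rep) : Prop :=
  (exists v : V, v <> 0) /\
  forall S : submod V, (forall h v, H h -> S v -> S (ract h v)) ->
    (forall v, S v -> v = 0) \/ (forall v, S v).

Definition injective_rep (I : rep) : Prop :=
  forall (A B : rep) (i : A -> B) (f : A -> I),
    is_rep_hom i -> injective i -> is_rep_hom f ->
    exists2 g : B -> I, is_rep_hom g & forall x, g (i x) = f x.

Record inj_resolution (W : rep) := InjResolution {
  res_obj :> nat -> rep;
  res_aug : W -> res_obj 0%N;
  res_diff : forall n, res_obj n -> res_obj n.+1;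
  res_aug_hom : is_rep_hom res_aug;
  res_diff_hom : forall n, is_rep_hom (@res_diff n);
  res_injective : forall n, injective_rep (res_obj n);
  res_aug_inj : injective res_aug;
  res_exact0 : forall x, @res_diff 0%N x = 0 <-> exists w, x = res_aug w;
  res_exactS : forall n x,
    @res_diff n.+1 x = 0 <-> exists y, x = @res_diff n y }.

End Reps.

Lemma linear_fun0 (k : fieldType) (U V : lmodType k) (f : U -> V) :
  linear f -> f 0 = 0.
Proof.
move=> lf; have := lf 1 0 0; rewrite !scale1r addr0 => /eqP.
by rewrite -subr_eq0 opprD addNKr oppr_eq0 => /eqP.
Qed.

Lemma submod_val0 (k : fieldType) (U : lmodType k) (S : submod U) :
  submod_val (0 : submod_type S) = 0.
Proof. exact: (raddf0 (val : submod_type S -> U)). Qed.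

Lemma submod_valZD (k : fieldType) (U : lmodType k) (S : submod U) a
    (x y : submod_type S) :
  submod_val (a *: x + y) = a *: submod_val x + submod_val y.
Proof. exact: (linearP (val : submod_type S -> U)). Qed.

Lemma fctZDE (k : fieldType) (T : Type) (V : lmodType k) (a : k) (f g : T -> V) x :
  (a *: f + g) x = a *: f x + g x.
Proof. by []. Qed.

Section HomExt.
Variables (k : fieldType) (G : topGroupType) (H : subgroup G).
Local Notation rep := (smoothRep k H).

Fact cocycles_subproof (V W : rep) (I : inj_resolution W) (n : nat) :
  let Z := [set f : V -> I n | is_rep_hom f /\ forall v, res_diff (f v) = 0] in
  Z 0 /\ forall a f g, Z f -> Z g -> Z (a *: f + g).
Proof.
move=> Z; have dlin := (res_diff_hom I n).1; split.
  split; first split.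
  - by move=> a x y /=; rewrite scaler0 addr0.
  - by move=> h v Hh /=; rewrite (linear_fun0 (ract_linear Hh)).
  - by move=> v; rewrite (linear_fun0 dlin).
move=> a f g [[fl fH] f0] [[gl gH] g0]; split; first split.
- move=> b x y; rewrite !fctZDE fl gl !scalerDr !scalerA.
  by rewrite (mulrC a b) addrACA.
- move=> h v Hh; rewrite !fctZDE fH // gH //.
  by rewrite (ract_linear Hh).
- by move=> v; rewrite dlin f0 g0 scaler0 addr0.
Qed.

(* Kernel and image at degree n of the complex Hom_H(V, I^0) -> Hom_H(V, I^1) -> ... *)
Definition cocycles (V W : rep) (I : inj_resolution W) (n : nat) : submod (V -> I n) :=
  Submod (cocycles_subproof V I n).1 (cocycles_subproof V I n).2.

Definition coboundary (V W : rep) (I : inj_resolution W) (n : nat) :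
    (V -> I n) -> Prop :=
  if n is m.+1 then
    fun f => exists2 g : V -> I m, is_rep_hom g & f = fun v => res_diff (g v)
  else fun f => f = 0.

Fact coboundaries_subproof (V W : rep) (I : inj_resolution W) (n : nat) :
  let B := [set f : submod_type (cocycles V I n) | coboundary (val f)] in
  B 0 /\ forall a f g, B f -> B g -> B (a *: f + g).
Proof.
case: n => [|n] B; split.
- by [].
- move=> a f g Bf Bg; rewrite /B /mkset /coboundary.
  by rewrite [LHS]submod_valZD [submod_val f]Bf [submod_val g]Bg scaler0 addr0.
- have dlin := (res_diff_hom I n).1; exists 0.
    split=> [a x y|h v Hh] /=; first by rewrite scaler0 addr0.
    by rewrite (linear_fun0 (ract_linear Hh)).
  by apply/funext => v; rewrite (linear_fun0 dlin).
- have dlin := (res_diff_hom I n).1.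
  move=> a f g [f' [fl fH] fE] [g' [gl gH] gE]; exists (a *: f' + g').
    split.
      move=> b x y; rewrite !fctZDE fl gl !scalerDr !scalerA.
      by rewrite (mulrC a b) addrACA.
    move=> h v Hh; rewrite !fctZDE fH // gH //.
    by rewrite (ract_linear Hh).
  rewrite [LHS]submod_valZD [submod_val f]fE [submod_val g]gE.
  by apply/funext => v; rewrite !fctZDE dlin.
Qed.

Definition coboundaries (V W : rep) (I : inj_resolution W) (n : nat) :
    submod (submod_type (cocycles V I n)) :=
  Submod (coboundaries_subproof V I n).1 (coboundaries_subproof V I n).2.

Definition Ext_of (V W : rep) (I : inj_resolution W) (n : nat) : lmodType k :=
  quotmod (coboundaries V I n).

End HomExt.

(* A smooth character of H, again extended arbitrarily to G. *)
Record smoothChar (k : fieldType) (G : topGroupType) (H : subgroup G) := SmoothChar {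
  char_fun :> G -> k;
  char1 : char_fun 1%g = 1;
  charM : forall g h, H g -> H h -> char_fun (g * h)%g = char_fun g * char_fun h;
  char_smooth : open_in H [set g | char_fun g = 1] }.
Arguments smoothChar k {G} H.

Section Characters.
Variables (k : fieldType) (G : topGroupType).
Implicit Types H K : subgroup G.

Lemma char_neq0 H (chi : smoothChar k H) g : H g -> chi g != 0.
Proof.
move=> Hg; apply/eqP => c0; have := char1 chi.
rewrite -(mulgV g) charM ?c0 ?mul0r //; last exact: subgroupV.
by move/eqP; rewrite eq_sym oner_eq0.
Qed.

Fact char_rep_smooth H (chi : smoothChar k H) (v : k^o) :
  open_in H [set g | chi g * v = v].
Proof.
have [U [oU U1 UA]] := open_in_nbhs (char_smooth chi) (char1 chi).
apply: (open_in_mulclosed oU U1) => [g Ug|x y Lx Ly /= xv yv] /=.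
  by rewrite (UA _ Ug) mul1r.
by rewrite charM // -mulrA yv xv.
Qed.

Definition char_rep H (chi : smoothChar k H) : smoothRep k H.
Proof.
refine (@SmoothRep k G H k^o (fun g v => chi g * v) _ _ _ (char_rep_smooth chi)).
- by move=> g _ a x y; rewrite mulrDr /GRing.scale /= mulrCA.
- by move=> v; rewrite char1 mul1r.
- by move=> g h v Hg Hh; rewrite charM // mulrA.
Defined.

Definition char_triv H : smoothChar k H.
Proof.
refine (@SmoothChar k G H (fun=> 1) erefl (fun _ _ _ _ => esym (mulr1 1)) _).
by exists setT; [exact: openT|apply/seteqP; split=> x [_ Lx]; split].
Defined.

Definition char_mul H (chi psi : smoothChar k H) : smoothChar k H.
Proof.
refine (@SmoothChar k G H (fun g => chi g * psi g) _ _ _).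
- by rewrite !char1 mulr1.
- by move=> g h Hg Hh; rewrite !charM // mulrACA.
- have [U [oU U1 UA]] := open_in_nbhs (char_smooth chi) (char1 chi).
  have [V [oV V1 VA]] := open_in_nbhs (char_smooth psi) (char1 psi).
  apply: (@open_in_mulclosed _ _ _ (U `&` V)) => //; first exact: openI.
    by move=> g [[Ug Vg] Hg] /=; rewrite (UA g) ?(VA g) ?mulr1.
  by move=> x y Lx Ly /= hx hy; rewrite !charM // mulrACA hx hy mulr1.
Defined.

Definition char_dual H (chi : smoothChar k H) : smoothChar k H.
Proof.
refine (@SmoothChar k G H (fun g => (chi g)^-1) _ _ _).
- by rewrite char1 invr1.
- by move=> g h Hg Hh; rewrite charM // invfM.
- have [U oU UA] := char_smooth chi; exists U => //; rewrite -UA.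
  by congr (_ `&` _); apply/seteqP; split=> g /= h; rewrite ?h ?invr1 // -[chi g]invrK h invr1.
Defined.

Definition char_res H K (sKH : forall x, K x -> H x) (chi : smoothChar k H) :
  smoothChar k K.
Proof.
refine (@SmoothChar k G K chi (char1 chi) _ _).
- by move=> g h Kg Kh; rewrite charM //; exact: sKH.
- have [U [oU U1 UA]] := open_in_nbhs (char_smooth chi) (char1 chi).
  apply: (open_in_mulclosed oU U1) => [g [Ug Kg]|x y Kx Ky /= hx hy].
    by apply: UA; split=> //; exact: sKH.
  by rewrite charM ?hx ?hy ?mulr1 //; exact: sKH.
Defined.

(* The character x |-> chi (s^-1 * x * s) of s H s^-1. *)
Definition char_conj H (s : G) (chi : smoothChar k H) :
  smoothChar k (conj_group s H).
Proof.
refine (@SmoothChar k G (conj_group s H) (fun x => chi (x ^ s)%g) _ _ _).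
- by rewrite conj1g char1.
- by move=> g h Hg Hh; rewrite conjMg charM.
- have [U oU UA] := char_smooth chi.
  exists ((fun x : G => (x ^ s)%g) @^-1` U).
    by apply: open_comp => // x _; exact: conjg_continuous.
  apply/seteqP; split=> x [/= h Hx]; split=> //.
    by have [] : (U `&` subgroup_set H) (x ^ s)%g by rewrite -UA.
  by have [] : ([set g | chi g = 1] `&` subgroup_set H) (x ^ s)%g by rewrite UA.
Defined.

End Characters.
Arguments char_triv {k G H}.

(* Functions f : L -> sigma (extended by 0 to G) such that f (h x) = h f(x) for h
   in H and f is right-invariant under an open subgroup of L; L acts by right
   translation.  This is Ind_H^L sigma when H is a subgroup of L. *)
Section Induction.
Variables (k : fieldType) (G : topGroupType) (H L : subgroup G).
Variable sigma : smoothRep k H.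

Definition right_stab (f : G -> sigma) : set G :=
  [set g | forall x, L x -> f (x * g)%g = f x].

Definition Ind_cond (f : G -> sigma) : Prop :=
  [/\ forall x, ~ L x -> f x = 0,
      forall h x, H h -> L x -> f (h * x)%g = ract h (f x)
    & open_in L (right_stab f)].

Lemma right_stab1 f : right_stab f 1%g.
Proof. by move=> x _; rewrite mulg1. Qed.

Lemma right_stabM f x y : L x -> L y ->
  right_stab f x -> right_stab f y -> right_stab f (x * y)%g.
Proof. by move=> Lx Ly fx fy z Lz; rewrite mulgA fy ?fx //; exact: subgroupM. Qed.

Fact Ind_submod_subproof :
  Ind_cond 0 /\ forall a f g, Ind_cond f -> Ind_cond g -> Ind_cond (a *: f + g).
Proof.
split.
  split=> //; first by move=> h x Hh _ /=; rewrite (linear_fun0 (ract_linear Hh)).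
  by exists setT; [exact: openT|apply/seteqP; split=> x [_ Lx]; split].
move=> a f g [f0 fH fo] [g0 gH go]; split.
- by move=> x Lx; rewrite !fctZDE f0 // g0 // scaler0 addr0.
- move=> h x Hh Lx; rewrite !fctZDE fH // gH //.
  by rewrite (ract_linear Hh).
- have [U [oU U1 UA]] := open_in_nbhs fo (@right_stab1 f).
  have [V [oV V1 VA]] := open_in_nbhs go (@right_stab1 g).
  apply: (@open_in_mulclosed _ _ _ (U `&` V)) => //; first exact: openI.
    move=> x [[Ux Vx] Lx] y Ly; rewrite !fctZDE.
    by rewrite (UA x) // (VA x).
  by move=> x y; exact: right_stabM.
Qed.

Definition Ind_submod : submod (G -> sigma) :=
  Submod Ind_submod_subproof.1 Ind_submod_subproof.2.

Definition rtrans (g : G) (f : G -> sigma) : G -> sigma :=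
  fun x => if `[< L g >] then f (x * g)%g else f x.

Fact rtrans_Ind g f : Ind_cond f -> Ind_cond (rtrans g f).
Proof.
rewrite /rtrans => -[f0 fH fo]; case: asboolP => Lg //; split.
- move=> x Lx; apply: f0 => Lxg; apply: Lx; rewrite -(mulgK g x).
  by apply: subgroupM => //; exact: subgroupV.
- by move=> h x Hh Lx; rewrite -mulgA fH //; exact: subgroupM.
- have [U [oU U1 UA]] := open_in_nbhs fo (@right_stab1 f).
  apply: (@open_in_mulclosed _ _ _ ((fun x : G => (x ^ g)%g) @^-1` U)).
  + by apply: open_comp => // x _; exact: conjg_continuous.
  + by rewrite /= conj1g.
  + move=> x [/= Ux Lx] y Ly; have Lxg : L (x ^ g)%g.
      by rewrite conjgE; do 2?apply: subgroupM => //; exact: subgroupV.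
    by rewrite -mulgA (conjgC x g) mulgA (UA (x ^ g)%g) //; exact: subgroupM.
  + by move=> x y; exact: right_stabM.
Qed.

Definition Ind_act (g : G) (f : submod_type Ind_submod) : submod_type Ind_submod :=
  @to_submod k _ Ind_submod (rtrans g (val f)) (rtrans_Ind g (set_mem (valP f))).

Lemma Ind_actE g f x : L g -> val (Ind_act g f) x = val f (x * g)%g.
Proof. by move=> Lg /=; rewrite /rtrans asboolT. Qed.

Lemma Ind_valZD a (f g : submod_type Ind_submod) x :
  val (a *: f + g) x = a *: val f x + val g x.
Proof. exact: (congr1 (@^~ x) (submod_valZD a f g)). Qed.

Lemma Ind_eq (f g : submod_type Ind_submod) :
  (forall x, L x -> val f x = val g x) -> f = g.
Proof.
move=> fg; apply/val_inj/funext => x.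
case: (pselect (L x)) => [/fg //|nLx].
by have [-> // _ _] := set_mem (valP f); have [-> // _ _] := set_mem (valP g).
Qed.

Fact Ind_act_smooth f : open_in L [set g | Ind_act g f = f].
Proof.
have [_ _ [U oU UA]] := set_mem (valP f); exists U => //; rewrite -UA.
apply/seteqP; split=> g [h Lg]; split=> //.
  by move=> x Lx; rewrite -Ind_actE // h.
by apply: Ind_eq => x Lx; rewrite Ind_actE // h.
Qed.

Definition Ind : smoothRep k L.
Proof.
refine (@SmoothRep k G L (submod_type Ind_submod) Ind_act _ _ _ Ind_act_smooth).
- move=> g Lg a f f'; apply: Ind_eq => x Lx.
  by rewrite Ind_actE // !Ind_valZD !Ind_actE.
- move=> f; apply: Ind_eq => x Lx; rewrite Ind_actE ?mulg1 //; exact: subgroup1.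
- move=> g h f Lg Lh; apply: Ind_eq => x Lx; rewrite !Ind_actE ?mulgA //.
  exact: subgroupM.
Defined.

End Induction.

Section LinearExtension.
Variables (k : fieldType) (A B V : lmodType k) (i : A -> B) (phi : A -> V).
Hypotheses (il : linear i) (iI : injective i) (phil : linear phi).

Let graph0 : set (B * V) := [set p | exists x, p = (i x, phi x)].
Let good (Y : set (B * V)) :=
  (forall a p q, Y p -> Y q -> Y (a *: p + q)) /\ (forall v, Y (0, v) -> v = 0).

Let good0 : good graph0.
Proof.
split.
  move=> a _ _ [x ->] [y ->]; exists (a *: x + y); rewrite il phil.
  by [].
move=> v [x [ix ->]]; have -> : x = 0 by apply: iI; rewrite -ix (linear_fun0 il).
exact: linear_fun0.
Qed.

Let pairZD a (x y : B) (u w : V) :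
  a *: (x, u) + (y, w) = (a *: x + y, a *: u + w) :> B * V.
Proof. by []. Qed.

Lemma linear_extension :
  exists2 psi : B -> V, linear psi & forall x, psi (i x) = phi x.
Proof.
have [F Fgood Ftot|X [Xg Xmax]] := @Zorn_bigcup (B * V)%type [set X | good (X `|` graph0)].
  split.
    move=> a p q [[X FX Xp]|gp] [[Y FY Yq]|gq].
    - have [XY|YX] := Ftot _ _ FX FY.
        have [||Yr|gr] := (Fgood _ FY).1 a p q;
          [by left; exact: XY|by left|by left; exists Y|by right].
      have [||Xr|gr] := (Fgood _ FX).1 a p q;
        [by left|by left; exact: YX|by left; exists X|by right].
    - have [||Xr|gr] := (Fgood _ FX).1 a p q;
        [by left|by right|by left; exists X|by right].
    - have [||Yr|gr] := (Fgood _ FY).1 a p q;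
        [by right|by left|by left; exists Y|by right].
    - by right; exact: good0.1.
  move=> v [[X FX Xv]|]; last exact: good0.2.
  by apply: (Fgood _ FX).2; left.
pose Y := X `|` graph0; have {}Xg : good Y by [].
have Y0 : Y 0 by right; exists 0; rewrite (linear_fun0 il) (linear_fun0 phil).
have YZ a p : Y p -> Y (a *: p).
  by move=> Yp; rewrite -[_ *: _]addr0; exact: Xg.1.
have Yfun b v v' : Y (b, v) -> Y (b, v') -> v = v'.
  move=> h h'; have /Xg.2 : Y (0, v - v').
    have := Xg.1 (-1) _ _ h' h.
    by rewrite pairZD !scaleN1r addNr (addrC _ v).
  by move/eqP; rewrite subr_eq0 => /eqP.
have Ytot b : exists v, Y (b, v).
  apply: contrapT => nb.
  pose Y' := [set p | exists c y, Y y /\ p = c *: ((b, 0) : B * V) + y].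
  have YY' : Y `<=` Y' by move=> p Yp; exists 0, p; rewrite scale0r add0r.
  apply: (Xmax Y').
    split; first by move=> p Xp; apply: YY'; left.
    move=> Y'X; apply: nb; exists 0; left; apply: Y'X; exists 1, 0.
    by rewrite scale1r addr0.
  rewrite /mkset; have -> : Y' `|` graph0 = Y'.
    by apply/setUidPl => p gp; apply: YY'; right.
  split.
    move=> a _ _ [c [y [Yy ->]]] [c' [y' [Yy' ->]]].
    exists (a * c + c'), (a *: y + y'); split; first exact: Xg.1.
    by rewrite scalerDr scalerA addrACA -scalerDl.
  move=> v [c [[y1 y2] [Yy]]]; rewrite pairZD scaler0 add0r => -[E ->].
  case: (eqVneq c 0) => [c0|c0].
    by apply: Xg.2; move: E Yy; rewrite c0 scale0r add0r => <-.
  case: nb; exists (- c^-1 *: y2).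
  suff -> : b = - c^-1 *: y1 by exact: (YZ _ _ Yy).
  have -> : y1 = - (c *: b) by apply/eqP; rewrite -addr_eq0 addrC -E.
  by rewrite scalerN scaleNr opprK scalerA mulVf // scale1r.
pose psi b := projT1 (cid (Ytot b)).
have psiP b : Y (b, psi b) by rewrite /psi; case: cid.
exists psi.
  move=> a x y; apply: Yfun (psiP _) _.
  exact: (Xg.1 a _ _ (psiP x) (psiP y)).
by move=> x; apply: Yfun (psiP _) _; right; exists x.
Qed.

End LinearExtension.

Section EnoughInjectives.
Variables (k : fieldType) (G : topGroupType) (H : subgroup G).
Local Notation rep := (smoothRep k H).

Definition forget_rep (V : lmodType k) : smoothRep k (@triv_group G).
Proof.
refine (@SmoothRep k G triv_group V (fun _ v => v) _ _ _ _) => //.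
by move=> v; exists setT; [exact: openT|apply/seteqP; split=> x [_ Lx]; split].
Defined.

Definition inj_env (V : lmodType k) : rep := Ind H (forget_rep V).

Lemma inj_env_injective V : injective_rep (inj_env V).
Proof.
move=> A B i f [il iH] iI [fl fH].
have phil : linear (fun x => val (f x) 1%g : V).
  by move=> a x y; rewrite fl; exact: (@Ind_valZD k G triv_group H (forget_rep V)).
have [psi psil psiE] := linear_extension il iI phil.
have gP (b : B) : @Ind_cond k G triv_group H (forget_rep V)
    (fun x => if `[< H x >] then psi (ract x b) else 0).
  split.
  - by move=> x Hx; rewrite asboolF.
  - by move=> h x -> Hx; rewrite mul1g.
  - have [U [oU U1 UA]] := open_in_nbhs (ract_smooth b) (ract1 b).
    apply: (open_in_mulclosed oU U1) => [x [Ux Hx] y Hy|x y].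
      by rewrite !asboolT ?ractM ?(UA x) //; exact: subgroupM.
    exact: right_stabM.
pose g b : inj_env V := to_submod (S := Ind_submod _ _) (gP b).
have gE b x : H x -> val (g b) x = psi (ract x b) by move=> Hx /=; rewrite asboolT.
exists g.
  split.
    move=> a x y; apply: Ind_eq => z Hz.
    by rewrite Ind_valZD !gE // (ract_linear Hz) psil.
  move=> h v Hh; apply: Ind_eq => z Hz.
  rewrite Ind_actE // !gE ?ractM //; exact: subgroupM.
move=> x; apply: Ind_eq => z Hz.
by rewrite gE // -iH // psiE fH // Ind_actE // mul1g.
Qed.

Lemma embed_subproof (V : rep) (v : V) : @Ind_cond k G triv_group H (forget_rep V)
  (fun x => if `[< H x >] then ract x v else 0).
Proof.
split.
- by move=> x Hx; rewrite asboolF.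
- by move=> h x -> Hx; rewrite mul1g.
- have [U [oU U1 UA]] := open_in_nbhs (ract_smooth v) (ract1 v).
  apply: (open_in_mulclosed oU U1) => [x [Ux Hx] y Hy|x y].
    by rewrite !asboolT ?ractM ?(UA x) //; exact: subgroupM.
  exact: right_stabM.
Qed.

Definition embed (V : rep) (v : V) : inj_env V :=
  to_submod (S := Ind_submod _ _) (embed_subproof v).

Lemma embedE (V : rep) (v : V) x : H x -> val (embed v) x = ract x v.
Proof. by move=> Hx /=; rewrite asboolT. Qed.

Lemma embed_hom (V : rep) : is_rep_hom (@embed V).
Proof.
split.
  move=> a x y; apply: Ind_eq => z Hz.
  by rewrite Ind_valZD !embedE // (ract_linear Hz).
move=> h v Hh; apply: Ind_eq => z Hz.
by rewrite Ind_actE // !embedE ?ractM //; exact: subgroupM.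
Qed.

Lemma embed_inj (V : rep) : injective (@embed V).
Proof.
move=> v w /(congr1 (fun f => val f 1%g)); rewrite !embedE ?ract1 //;
  exact: subgroup1.
Qed.

Section Quotient.
Variables (V : rep) (S : submod V).
Hypothesis SH : forall h v, H h -> S v -> S (ract h v).

Definition quot_act (g : G) (q : quotmod S) : quotmod S :=
  if `[< H g >] then qpi S (ract g (qrepr q)) else q.

Lemma quot_actE g v : H g -> quot_act g (qpi S v) = qpi S (ract g v).
Proof.
move=> Hg; rewrite /quot_act asboolT //; apply/qpi_eq.
have := SH Hg (qrepr_pi S v); rewrite -scaleN1r addrC (ract_linear Hg).
by rewrite scaleN1r addrC.
Qed.

Definition quot_rep : rep.
Proof.
refine (@SmoothRep k G H (quotmod S) quot_act _ _ _ _).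
- move=> g Hg a p q; case: (qpiP p) (qpiP q) => [x ->] [y ->].
  by rewrite -linearP !quot_actE // (ract_linear Hg) linearP.
- move=> q; case: (qpiP q) => [x ->].
  by rewrite quot_actE ?ract1 //; exact: subgroup1.
- move=> g h q Hg Hh; case: (qpiP q) => [x ->].
  by rewrite !quot_actE ?ractM //; exact: subgroupM.
- move=> q; case: (qpiP q) => [x ->].
  have [U [oU U1 UA]] := open_in_nbhs (ract_smooth x) (ract1 x).
  apply: (open_in_mulclosed oU U1) => [g [Ug Hg]|g h Hg Hh] /=.
    by rewrite quot_actE // (UA g).
  move=> gx hx; rewrite quot_actE ?ractM //; last exact: subgroupM.
  by rewrite -quot_actE // -(quot_actE x Hh) hx gx.
Defined.

End Quotient.

Fact image_subproof (V W : rep) (f : V -> W) : is_rep_hom f ->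
  [/\ exists v, 0 = f v,
      forall a x y, (exists v, x = f v) -> (exists v, y = f v) ->
        exists v, a *: x + y = f v
    & forall h x, H h -> (exists v, x = f v) -> exists v, ract h x = f v].
Proof.
move=> [fl fH]; split.
- by exists 0; rewrite (linear_fun0 fl).
- by move=> a _ _ [v ->] [w ->]; exists (a *: v + w); rewrite fl.
- by move=> h _ Hh [v ->]; exists (ract h v); rewrite fH.
Qed.

Definition embed_image (V : rep) : submod (inj_env V).
Proof.
refine (@Submod k (inj_env V) [set x | exists v, x = embed v] _ _);
  by have [] := image_subproof (@embed_hom V).
Defined.

Definition cosyzygy (V : rep) : rep.
Proof.
refine (@quot_rep (inj_env V) (embed_image V) _).
by have [] := image_subproof (@embed_hom V).
Defined.

Lemma inj_resolution_exists (W : rep) : exists I : inj_resolution W, True.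
Proof.
pose C n := iter n cosyzygy W.
pose I n := inj_env (C n).
pose p n (x : I n) : C n.+1 := qpi (embed_image (C n)) x.
pose d n (x : I n) : I n.+1 := embed (p n x).
have p_hom n : is_rep_hom (@p n).
  split; first by move=> a x y; exact: (linearP (qpi (embed_image (C n)))).
  by move=> h x Hh; rewrite /p /= quot_actE //;
    have [] := image_subproof (@embed_hom (C n)).
have d_hom n : is_rep_hom (@d n).
  have [pl pH] := p_hom n; have [el eH] := @embed_hom (C n.+1).
  by split=> [a x y|h x Hh]; rewrite /d ?pl ?el // pH // eH.
have d0 n x : d n x = 0 <-> exists y : C n, x = embed y.
  have e0 := linear_fun0 (@embed_hom (C n.+1)).1.
  rewrite /d; split=> [h|[y xE]].
    by apply/(qpi_eq0 (embed_image (C n))); apply: (@embed_inj (C n.+1)); rewrite e0.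
  rewrite -e0; congr embed; apply/(qpi_eq0 (embed_image (C n))).
  by exists y.
suff I0 : inj_resolution W by exists I0.
apply: (@InjResolution k G H W I (@embed W) d).
- exact: embed_hom.
- exact: d_hom.
- by move=> n; exact: inj_env_injective.
- exact: embed_inj.
- exact: d0.
- move=> n x; rewrite d0; split=> -[y ->].
    by have [z ->] := qpiP y; exists z.
  by exists (p n y).
Qed.

Definition inj_res (W : rep) : inj_resolution W :=
  projT1 (cid (inj_resolution_exists W)).

Definition Ext (n : nat) (V W : rep) : lmodType k := Ext_of V (inj_res W) n.

End EnoughInjectives.

(* Normalized discrete valuation, written additively; the value at 0 is irrelevant. *)
Record valuation (R : nzRingType) := Valuation {
  val_fun :> R -> int;
  valuationM : forall x y, x != 0 -> y != 0 -> val_fun (x * y) = val_fun x + val_fun y;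
  valuationD : forall x y, x != 0 -> y != 0 -> x + y != 0 ->
    Num.min (val_fun x) (val_fun y) <= val_fun (x + y);
  valuation_surj : exists2 x, x != 0 & val_fun x = 1 }.

Section Valuation.
Variables (R : nzRingType) (w : valuation R).

Definition val_ge (m : int) : set R := [set x | x = 0 \/ m <= w x].
Definition val_ring : set R := val_ge 0.
Definition val_maxideal : set R := val_ge 1.
Definition val_uniformizer (x : R) : Prop := x != 0 /\ w x = 1.

Definition val_cauchy (u : nat -> R) : Prop :=
  forall m : int, exists N : nat, forall i j : nat,
    (N <= i)%N -> (N <= j)%N -> val_ge m (u i - u j).

Definition val_converges (u : nat -> R) (l : R) : Prop :=
  forall m : int, exists N : nat, forall i : nat, (N <= i)%N -> val_ge m (u i - l).

Definition val_complete : Prop :=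
  forall u : nat -> R, val_cauchy u -> exists l, val_converges u l.

Definition finite_residue : Prop :=
  exists s : seq R, forall x, val_ring x -> exists2 y, y \in s & val_maxideal (x - y).

Lemma val_geD m x y : val_ge m x -> val_ge m y -> val_ge m (x + y).
Proof.
have [->|x0] := eqVneq x 0; first by rewrite add0r.
have [->|y0] := eqVneq y 0; first by rewrite addr0.
have [xy0|xy0] := eqVneq (x + y) 0; first by left.
case=> [/eqP|mx]; first by rewrite (negbTE x0).
case=> [/eqP|my]; first by rewrite (negbTE y0).
by right; apply: le_trans (valuationD w x0 y0 xy0); rewrite le_min mx.
Qed.

Lemma valuation1 : w 1 = 0.
Proof.
have := valuationM w (oner_neq0 R) (oner_neq0 R); rewrite mulr1.
by move/eqP; rewrite -subr_eq subrr eq_sym => /eqP.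
Qed.

Lemma valuationN1 : w (-1) = 0.
Proof.
have N10 : (-1 : R) != 0 by rewrite oppr_eq0 oner_neq0.
have := valuationM w N10 N10; rewrite mulrNN mulr1 valuation1 => /esym/eqP.
by rewrite -mulr2n mulrn_eq0 /= => /eqP.
Qed.

Lemma val_geN m x : val_ge m x -> val_ge m (- x).
Proof.
have [->|x0] := eqVneq x 0; first by rewrite oppr0.
case=> [/eqP|mx]; first by rewrite (negbTE x0).
by right; rewrite -mulN1r valuationM ?oppr_eq0 ?oner_neq0 // valuationN1 add0r.
Qed.

Lemma val_geM m n x y : val_ge m x -> val_ge n y -> val_ge (m + n) (x * y).
Proof.
have [->|x0] := eqVneq x 0; first by rewrite mul0r; left.
have [->|y0] := eqVneq y 0; first by rewrite mulr0; left.
case=> [/eqP|mx]; first by rewrite (negbTE x0).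
case=> [/eqP|my]; first by rewrite (negbTE y0).
by right; rewrite valuationM // lerD.
Qed.

Lemma val_ringM x y : val_ring x -> val_ring y -> val_ring (x * y).
Proof. exact: (@val_geM 0 0). Qed.

Lemma val_ge_le m n x : n <= m -> val_ge m x -> val_ge n x.
Proof. by move=> nm [->|mx]; [left|right; exact: le_trans mx]. Qed.

End Valuation.

(* F is a non-Archimedean local field of residue characteristic p, with
   normalized valuation v. *)
Definition nonarch_local_field (p : nat) (F : fieldType) (v : valuation F) : Prop :=
  [/\ val_complete v, finite_residue v, prime p & val_maxideal v p%:R].

(* Since v is normalized, v(p) is the ramification index e of F over Q_p:
   p > d e + 1 in the p-adic case, gcd(p, d) = 1 in the function field case. *)
Definition char_assumption (p d : nat) (F : fieldType) (v : valuation F) : Prop :=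
  ([pchar F] =i pred0 -> (d%:Z * v p%:R + 1 < p%:Z)) /\
  (p \in [pchar F] -> coprime p d).

Definition central_division_algebra (F : fieldType) (d : nat) (D : falgType F) : Prop :=
  [/\ forall x : D, x != 0 -> x \is a GRing.unit,
      ('Z({:D}) = 1)%VS
    & \dim {:D} = (d ^ 2)%N].

Definition valuation_extends (F : fieldType) (D : falgType F)
    (v : valuation F) (w : valuation D) : Prop :=
  forall c : F, val_ring v c <-> val_ring w c%:A.

(* The group of units of R, with the topology induced by the valuation w. *)
Record units (R : unitRingType) (w : valuation R) := Units {
  units_val : R;
  units_valP : units_val \is a GRing.unit }.

Section Units.
Variables (R : unitRingType) (w : valuation R).
Local Notation U := (units w).

HB.instance Definition _ := [isSub for @units_val R w].
HB.instance Definition _ := [Choice of U by <:].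

Definition units_one : U := Units w (unitr1 R).
Fact units_mulP (x y : U) : val x * val y \is a GRing.unit.
Proof. by rewrite unitrMl; exact: units_valP. Qed.
Definition units_mul (x y : U) : U := Units w (units_mulP x y).
Fact units_invP (x : U) : (val x)^-1 \is a GRing.unit.
Proof. by rewrite unitrV; exact: units_valP. Qed.
Definition units_inv (x : U) : U := Units w (units_invP x).

Fact units_mulA : associative units_mul.
Proof. by move=> x y z; apply: val_inj => /=; rewrite mulrA. Qed.
Fact units_mul1 : left_id units_one units_mul.
Proof. by move=> x; apply: val_inj => /=; rewrite mul1r. Qed.
Fact units_mulr1 : right_id units_one units_mul.
Proof. by move=> x; apply: val_inj => /=; rewrite mulr1. Qed.
Fact units_mulV : left_inverse units_one units_inv units_mul.
Proof. by move=> x; apply: val_inj => /=; rewrite mulVr //; exact: units_valP. Qed.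
Fact units_mulrV : right_inverse units_one units_inv units_mul.
Proof. by move=> x; apply: val_inj => /=; rewrite divrr //; exact: units_valP. Qed.

HB.instance Definition _ := isGroup.Build U
  units_mulA units_mul1 units_mulr1 units_mulV units_mulrV.

Definition units_ball (x : U) (m : int) : set U :=
  [set y | val_ge w m (val y - val x)].

Definition units_open : set_system U :=
  [set A | forall x, A x -> exists m, units_ball x m `<=` A].

Fact units_openT : units_open setT.
Proof. by move=> x _; exists 0. Qed.
Fact units_openI : setI_closed units_open.
Proof.
move=> A B oA oB x [/oA [m mA] /oB [n nB]]; exists (Num.max m n) => y hy.
split; [apply: mA|apply: nB]; apply: val_ge_le hy; by rewrite le_max lexx ?orbT.
Qed.
Fact units_open_bigU (I : Type) (f : I -> set U) :
  (forall i, units_open (f i)) -> units_open (\bigcup_i f i).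
Proof.
move=> of_ x [i _ /of_ [m mf]]; exists m => y /mf fy; by exists i.
Qed.

HB.instance Definition _ :=
  isOpenTopological.Build U units_openT units_openI units_open_bigU.

Lemma units_neq0 (x : U) : val x != 0.
Proof. by apply: contraTneq (units_valP x) => ->; rewrite unitr0. Qed.

Lemma units_nbhs (x : U) m : nbhs x (units_ball x m).
Proof.
exists (units_ball x m); split=> [y hy||//]; last by left; rewrite subrr.
exists m => z hz; rewrite /units_ball /= -(subrKA (val y)).
exact: val_geD.
Qed.

Lemma units_nbhsP (x : U) (A : set U) : nbhs x A -> exists m, units_ball x m `<=` A.
Proof. by move=> [B [oB Bx BA]]; have [m mB] := oB x Bx; exists m => y /mB /BA. Qed.

Lemma valuationV (x : U) : w (val x)^-1 = - w (val x).
Proof.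
apply/eqP; rewrite -addr_eq0 -valuationM ?units_neq0 //.
  by rewrite mulVr ?units_valP // valuation1.
exact: (units_neq0 (units_inv x)).
Qed.

Lemma units_ball_val (x y : U) : units_ball x (w (val x) + 1) y -> w (val y) <= w (val x).
Proof.
move=> hy; rewrite leNgt; apply/negP => xy.
have hy' : val_ge w (w (val x) + 1) (val y) by right; rewrite lezD1.
have := val_geD hy' (val_geN hy); rewrite opprB subrKC.
case=> [/eqP|]; first by rewrite (negbTE (units_neq0 x)).
by rewrite lezD1 ltxx.
Qed.

Fact units_mul_continuous : continuous (fun xy : U * U => (xy.1 * xy.2)%g).
Proof.
move=> [x y] A /units_nbhsP [m mA] /=.
pose M := Num.max (m - w (val x)) (Num.max (m - w (val y)) (w (val y))).
exists (units_ball x M, units_ball y M).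
  by split; exact: units_nbhs.
move=> [x' y'] [/= hx hy]; apply: mA; rewrite /units_ball /=.
have -> : val x' * val y' - val x * val y =
    (val x' - val x) * (val y' - val y) + ((val x' - val x) * val y + val x * (val y' - val y)).
  by rewrite addrA -mulrDr subrK mulrBl mulrBr subrKA.
have le1 : m - w (val x) <= M by rewrite /M le_max lexx.
have le2 : m - w (val y) <= M by rewrite /M !le_max lexx orbT.
have le3 : w (val y) <= M by rewrite /M !le_max lexx !orbT.
apply: val_geD; [|apply: val_geD].
- apply: (@val_ge_le _ _ ((m - w (val y)) + w (val y))); first by rewrite subrK.
  by apply: val_geM; [exact: val_ge_le hx|exact: val_ge_le hy].
- apply: (@val_ge_le _ _ ((m - w (val y)) + w (val y))); first by rewrite subrK.
  by apply: val_geM; [exact: val_ge_le hx|right].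
- apply: (@val_ge_le _ _ (w (val x) + (m - w (val x)))); first by rewrite addrC subrK.
  by apply: val_geM; [right|exact: val_ge_le hy].
Qed.

Fact units_inv_continuous : continuous (fun x : U => (x^-1)%g).
Proof.
move=> x A /units_nbhsP [m mA] /=.
pose M := Num.max (w (val x) + 1) (m + w (val x) + w (val x)).
apply: (filterS _ (units_nbhs x M)) => y hy; apply: mA; rewrite /units_ball /=.
have yx : w (val y) <= w (val x).
  by apply: units_ball_val; apply: val_ge_le hy; rewrite /M le_max lexx.
have -> : (val y)^-1 - (val x)^-1 = (val y)^-1 * (val x - val y) * (val x)^-1.
  rewrite mulrBr mulrBl mulVr ?units_valP // mul1r.
  by rewrite -mulrA divrr ?units_valP // mulr1.
apply: (@val_ge_le _ _ (- w (val x) + (m + w (val x) + w (val x)) + - w (val x))).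
  by rewrite (addrC (- w (val x))) !addrK.
apply: val_geM; first apply: val_geM.
- by right; rewrite valuationV lerN2.
- by rewrite -opprB; apply: val_geN; apply: val_ge_le hy; rewrite /M le_max lexx orbT.
- by right; rewrite valuationV.
Qed.

HB.instance Definition _ :=
  isTopGroup.Build U units_mul_continuous units_inv_continuous.

Definition val_units : subgroup U.
Proof.
refine (@Subgroup U [set x | val_ring w (val x) /\ val_ring w (val x)^-1] _ _ _).
- by rewrite /= invr1; split; right; rewrite valuation1.
- move=> x y [hx hx'] [hy hy']; rewrite /= invrM ?units_valP //.
  by split; exact: val_ringM.
- by move=> x [hx hx'] /=; rewrite invrK.
Defined.

Lemma val_unitsP (x : U) : val_units x <-> w (val x) = 0.
Proof.
split=> [[]|w0]; last by split; right; rewrite ?valuationV w0.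
case=> [/eqP|h]; first by rewrite (negbTE (units_neq0 x)).
case=> [/eqP|]; first by rewrite (negbTE (units_neq0 (units_inv x))).
by rewrite valuationV oppr_ge0 => h'; apply/eqP; rewrite eq_le h h'.
Qed.

Lemma units_wM (x y : U) : w (val (x * y)%g) = w (val x) + w (val y).
Proof. by apply: valuationM; exact: units_neq0. Qed.

Lemma units_wV (x : U) : w (val (x^-1)%g) = - w (val x).
Proof. exact: valuationV. Qed.

Lemma val_units_conj (x y : U) : val_units x -> val_units (x ^ y)%g.
Proof.
move=> /val_unitsP x0; apply/val_unitsP.
by rewrite conjgE !units_wM units_wV x0 add0r addNr.
Qed.

End Units.

Section Dsub.
Variables (F : fieldType) (D : falgType F) (w : valuation D).
Local Notation U := (units w).
Local Open Scope group_scope.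

Definition scalar_units : subgroup U.
Proof.
refine (@Subgroup U [set x | exists c : F, val x = c%:A] _ _ _).
- by exists 1%R; rewrite /= scale1r.
- by move=> x y [c xc] [c' yc]; exists (c * c')%R; rewrite /= xc yc -scalerAl mul1r scalerA.
- move=> x [c xc]; exists (c^-1)%R; rewrite /= xc.
  have c0 : c != 0%R.
    by apply: contraTneq (units_neq0 x) => c0; rewrite xc c0 scale0r eqxx.
  by rewrite invrZ ?unitfE ?unitr1 // invr1.
Defined.

Lemma scalar_units_comm (c x : U) : scalar_units c -> commute c x.
Proof.
move=> [a ca]; apply: val_inj; rewrite /= ca.
by rewrite -scalerAl mul1r -scalerAr mulr1.
Qed.

Definition Dsub_set (varpi : U) (a : nat) : set U :=
  [set x | exists c u z, [/\ scalar_units c, val_units w u,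
     gen_group [set varpi ^+ a] z & x = c * u * z]].

(* D_a^* = F^* O_D^* <varpi^a> *)
Definition Dsub (varpi : U) (a : nat) : subgroup U.
Proof.
refine (@Subgroup U (Dsub_set varpi a) _ _ _).
- by exists 1, 1, 1; split; rewrite ?mulg1 //; exact: subgroup1.
- move=> _ _ [c [u [z [hc hu hz ->]]]] [c' [u' [z' [hc' hu' hz' ->]]]].
  exists (c * c'), (u * (u' ^ z^-1)), (z * z'); split.
  + exact: subgroupM.
  + by apply: subgroupM => //; exact: val_units_conj.
  + exact: subgroupM.
  + rewrite conjgE invgK !mulgA mulgVK; congr (_ * _ * _).
    rewrite -!mulgA; congr (c * _); rewrite mulgA.
    exact: (esym (scalar_units_comm (u * z) hc')).
- move=> _ [c [u [z [hc hu hz ->]]]].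
  exists c^-1, ((u^-1) ^ z), z^-1; split.
  + exact: subgroupV.
  + by apply: val_units_conj; exact: subgroupV.
  + exact: subgroupV.
  + rewrite conjgE !invgM !mulgA mulgK.
    rewrite -[RHS]mulgA.
    exact: (esym (scalar_units_comm _ (subgroupV hc))).
Defined.

Lemma scalar_Dsub varpi a x : scalar_units x -> Dsub varpi a x.
Proof. by move=> hx; exists x, 1, 1; split; rewrite ?mulg1 //; exact: subgroup1. Qed.

Lemma val_units_Dsub varpi a x : val_units w x -> Dsub varpi a x.
Proof. by move=> hx; exists 1, x, 1; split; rewrite ?mulg1 ?mul1g //; exact: subgroup1. Qed.

Lemma gen_Dsub varpi a x : gen_group [set varpi ^+ a] x -> Dsub varpi a x.
Proof. by move=> hx; exists 1, 1, x; split; rewrite ?mul1g //; exact: subgroup1. Qed.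

Lemma Dsub_normal varpi a x s : Dsub varpi a x -> Dsub varpi a (x ^ s).
Proof.
move=> [c [u [z [hc hu hz ->]]]]; rewrite !conjMg; apply: subgroupM.
  apply: subgroupM; last by apply: val_units_Dsub; exact: val_units_conj.
  rewrite conjgE (scalar_units_comm s hc) mulKg; exact: scalar_Dsub.
apply: (hz (conj_group s (Dsub varpi a))) => y ->.
change (Dsub varpi a ((varpi ^+ a) ^ s)).
rewrite -[_ ^ s](mulgVK (varpi ^+ a)); apply: subgroupM.
  apply: val_units_Dsub; apply/val_unitsP.
  by rewrite conjgE !units_wM !units_wV addrCA addNr addr0 subrr.
by apply: gen_Dsub => K; apply.
Qed.

Lemma Dsub_dvd varpi a b x : (a %| b)%N -> Dsub varpi b x -> Dsub varpi a x.
Proof.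
move=> /dvdnP[q ->] [c [u [z [hc hu hz ->]]]]; exists c, u, z; split=> //.
apply: hz => _ ->; rewrite mulnC expgnA; elim: q => [|q IH].
  exact: subgroup1.
by rewrite expgS; apply: subgroupM => // K; apply.
Qed.

Lemma Dsub_sub_conj varpi a b s x : (a %| b)%N ->
  Dsub varpi b x -> conj_group s (Dsub varpi a) x.
Proof. by move=> ab /(Dsub_dvd ab) /(Dsub_normal s). Qed.

Lemma Dsub_lcml varpi a b s x :
  Dsub varpi (lcmn a b) x -> conj_group s (Dsub varpi a) x.
Proof. by apply: Dsub_sub_conj; exact: dvdn_lcml. Qed.

Lemma Dsub_lcmr varpi a b x : Dsub varpi (lcmn a b) x -> Dsub varpi b x.
Proof. by apply: Dsub_dvd; exact: dvdn_lcmr. Qed.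

End Dsub.

(* Main.v *)
From HB Require Import structures.
Require Import Defs.
From mathcomp Require Import all_boot all_order all_algebra all_field.
From mathcomp Require Import all_classical.
From mathcomp Require Import topology.

Set Implicit Arguments.
Unset Strict Implicit.
Unset Printing Implicit Defensive.

Import Order.TTheory GRing.Theory Num.Theory.

Local Open Scope classical_set_scope.
Local Open Scope ring_scope.

(* Let I be an injective resolution of chi' over K = D_a' (that is, the group
   F^x O_D^x <varpi^a'>).  Induction from K to G = D^x is exact and preserves
   injectives, so Ind I resolves pi'.  Restriction to L = D_lcm followed by the
   twist by (chi^s)^-1 also preserves injective resolutions.  A G-map f from
   Ind_H^G chi, H = D_a, to Ind_K^G J is determined by the vectors f(s delta)(1)
   of J, where delta is chi extended by 0 and s runs over K \ G / H; the vector
   at s is an arbitrary one on which L = K \cap s H s^-1 acts by chi^s.  For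
   J = I^n this identifies the complex Hom_G(pi, Ind I) with the direct sum over
   s of the complexes Hom_L(1, I twisted by (chi^s)^-1), and Ext does not depend
   on the chosen resolution. *)

(** * Linear algebra: linear maps, quotients and direct sums *)

Section LinearFun.
Variables (k : fieldType) (U V : lmodType k) (f : U -> V).
Hypothesis fl : linear f.

Lemma linear_funD x y : f (x + y) = f x + f y.
Proof. by have := fl 1 x y; rewrite !scale1r. Qed.

Lemma linear_funZ a x : f (a *: x) = a *: f x.
Proof. by rewrite -[a *: x]addr0 fl (linear_fun0 fl) addr0. Qed.

Lemma linear_funN x : f (- x) = - f x.
Proof. by rewrite -scaleN1r linear_funZ scaleN1r. Qed.

Lemma linear_funB x y : f (x - y) = f x - f y.
Proof. by rewrite linear_funD linear_funN. Qed.

Lemma linear_fun_sum (T : Type) (r : seq T) (P : pred T) (F : T -> U) :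
  f (\sum_(t <- r | P t) F t) = \sum_(t <- r | P t) f (F t).
Proof. exact: (big_morph f linear_funD (linear_fun0 fl)). Qed.

Lemma first_isomorphism (S : submod U) :
  (forall x, f x = 0 <-> S x) -> (forall y, exists x, y = f x) ->
  lmod_iso (quotmod S) V.
Proof.
move=> kerf surjf; pose g (q : quotmod S) := f (qrepr q).
have gE x : g (qpi S x) = f x.
  have /kerf := qrepr_pi S x; rewrite linear_funB => /eqP.
  by rewrite subr_eq0 => /eqP.
have gl : linear g.
  move=> a p q; have [x ->] := qpiP p; have [y ->] := qpiP q.
  by rewrite -linearP !gE fl.
pose gL := GRing.isLinear.Build k (quotmod S) V *:%R g gl.
pose G : {linear quotmod S -> V} := HB.pack g gL.
exists G; pose h y := qpi S (projT1 (cid (surjf y))).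
exists h => [q|y]; rewrite /= /h; case: cid => x /=.
  have [z ->] := qpiP q; rewrite gE => /esym fE.
  by apply/qpi_eq/kerf; rewrite linear_funB fE subrr.
by rewrite gE => <-.
Qed.

End LinearFun.

Lemma lmod_iso_trans (k : fieldType) (A B C : lmodType k) :
  lmod_iso A B -> lmod_iso B C -> lmod_iso A C.
Proof.
move=> [f fb] [g gb]; exists ((g \o f)%FUN : {linear A -> C}).
exact: bij_comp.
Qed.

Lemma dsum_iso (k : fieldType) (X : Type) (M N : X -> lmodType k) :
  (forall x, lmod_iso (M x) (N x)) -> lmod_iso (dsum M) (dsum N).
Proof.
move=> MN; pose f x : {linear M x -> N x} := projT1 (cid (MN x)).
have fb x : bijective (f x) by rewrite /f; case: cid.
have fV x : exists g : N x -> M x, cancel (f x) g /\ cancel g (f x).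
  by case: (fb x) => g; exists g.
pose g x := projT1 (cid (fV x)).
have gK x : cancel (f x) (g x) /\ cancel (g x) (f x) by rewrite /g; case: cid.
have g0 x : g x 0 = 0 by rewrite -(linear0 (f x)) (gK x).1.
have Ffin (m : dsum M) : finite_set [set x | f x (m x) != 0].
  apply: (sub_finite_set _ (dsum_finite m)) => x /=; apply: contra => /eqP ->.
  by rewrite linear0.
have Gfin (m : dsum N) : finite_set [set x | g x (m x) != 0].
  apply: (sub_finite_set _ (dsum_finite m)) => x /=; apply: contra => /eqP ->.
  by rewrite g0.
pose F m := Dsum (Ffin m).
have Fl : linear F by move=> a x y; apply: dsum_eq => c /=; rewrite linearP.
pose FL := GRing.isLinear.Build k (dsum M) (dsum N) *:%R F Fl.
exists (HB.pack F FL : {linear dsum M -> dsum N}).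
exists (fun m => Dsum (Gfin m)) => m; apply: dsum_eq => x /=.
  exact: (gK x).1.
exact: (gK x).2.
Qed.

(** Serves to build chain maps and homotopies degree by degree: [P] is the invariant that makes the
    next choice possible, [R] the relation between consecutive degrees. *)
Lemma dependent_choice_nat (T : nat -> Type) (P : forall n, T n -> Prop)
    (R : forall n, T n -> T n.+1 -> Prop) (x0 : T 0%N) :
  P 0%N x0 -> (forall n x, P n x -> exists2 y, P n.+1 y & R n x y) ->
  exists2 f : forall n, T n, f 0%N = x0 & forall n, P n (f n) /\ R n (f n) (f n.+1).
Proof.
move=> P0 step.
pose next n (x : {x : T n | P n x}) : {y : T n.+1 | P n.+1 y} :=
  let e := cid2 (step n (sval x) (svalP x)) in exist _ (s2val e) (s2valP e).
pose f := nat_rect (fun n => {x : T n | P n x}) (exist _ x0 P0) next.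
exists (fun n => sval (f n)) => // n; split; first exact: svalP.
exact: (s2valP' (cid2 (step n (sval (f n)) (svalP (f n))))).
Qed.

(** * Comparison of injective resolutions *)

Section RepHom.
Variables (k : fieldType) (G : topGroupType) (H : subgroup G).
Local Notation rep := (smoothRep k H).

Lemma rep_hom_comp (A B C : rep) (f : A -> B) (g : B -> C) :
  is_rep_hom f -> is_rep_hom g -> is_rep_hom (fun x => g (f x)).
Proof. by move=> [fl fH] [gl gH]; split=> [a x y|h v Hh]; rewrite ?fl ?gl ?fH ?gH. Qed.

Lemma rep_homB (A B : rep) (f g : A -> B) :
  is_rep_hom f -> is_rep_hom g -> is_rep_hom (fun x => f x - g x).
Proof.
move=> [fl fH] [gl gH]; split=> [a x y|h v Hh].
  by rewrite fl gl opprD addrACA scalerBr.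
by rewrite fH // gH // (linear_funB (ract_linear Hh)).
Qed.

Lemma rep_hom_id (A : rep) : is_rep_hom (@id A).
Proof. by []. Qed.

(** Both maps descend to the quotient of A by the kernel of [p], where [p] becomes injective, so
    injectivity of J applies there. In this form it can be used with a differential as [p]. *)
Lemma injective_rep_factor (J A B : rep) (p : A -> B) (q : A -> J) :
  injective_rep J -> is_rep_hom p -> is_rep_hom q -> (forall x, p x = 0 -> q x = 0) ->
  exists2 g : B -> J, is_rep_hom g & forall x, g (p x) = q x.
Proof.
move=> Jinj [pl pH] [ql qH] pq.
have S0 : p 0 = 0 by rewrite linear_fun0.
have SZD a x y : p x = 0 -> p y = 0 -> p (a *: x + y) = 0.
  by move=> x0 y0; rewrite pl x0 y0 scaler0 addr0.
pose S : submod A := Submod S0 SZD.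
have SH h v : H h -> S v -> S (ract h v).
  by move=> Hh /= v0; rewrite pH // v0 (linear_fun0 (ract_linear Hh)).
pose Q := quot_rep SH.
have pE x : p (qrepr (qpi S x)) = p x.
  by have := qrepr_pi S x; rewrite /= (linear_funB pl) => /eqP; rewrite subr_eq0 => /eqP.
have qE x : q (qrepr (qpi S x)) = q x.
  have := qrepr_pi S x; rewrite /= => /pq.
  by rewrite (linear_funB ql) => /eqP; rewrite subr_eq0 => /eqP.
have homQ (W : rep) (r : A -> W) : is_rep_hom r ->
    (forall x, r (qrepr (qpi S x)) = r x) ->
    is_rep_hom (fun z : Q => r (qrepr (z : quotmod S))).
  move=> [rl rH] rE; split.
    move=> a z z'; have [x ->] := qpiP z; have [y ->] := qpiP z'.
    by rewrite -linearP !rE rl.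
  move=> h z Hh; have [x ->] := qpiP z.
  by rewrite /= quot_actE // !rE rH.
have [|||g gh gE] := Jinj Q B (fun z : Q => p (qrepr (z : quotmod S)))
    (fun z : Q => q (qrepr (z : quotmod S))).
- exact: homQ.
- move=> z z'; have [x ->] := qpiP z; have [y ->] := qpiP z'.
  rewrite !pE => pxy; apply/qpi_eq => /=.
  by rewrite (linear_funB pl) pxy subrr.
- exact: homQ.
exists g => // x; have := gE (qpi S x).
by rewrite pE qE.
Qed.

Section Comparison.
Variables (V W : rep).
Implicit Types I J : inj_resolution W.

Lemma res_diffK I n (x : I n) : res_diff (res_diff x) = 0.
Proof. by apply/res_exactS; exists x. Qed.

Lemma res_diff_aug I w : @res_diff _ _ _ _ I 0%N (res_aug I w) = 0.
Proof. by apply/res_exact0; exists w. Qed.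

Definition chain_map I J (phi : forall n, I n -> J n) : Prop :=
  forall n, is_rep_hom (phi n) /\
    forall x, phi n.+1 (res_diff x) = res_diff (phi n x).

Lemma chain_map_exists I J : exists2 phi : forall n, I n -> J n,
  chain_map phi & forall w, phi 0%N (res_aug I w) = res_aug J w.
Proof.
have [|||f0 f0h f0E] := @injective_rep_factor (J 0%N) W (I 0%N) (res_aug I)
    (res_aug J) (@res_injective _ _ _ _ J 0%N).
- exact: res_aug_hom.
- exact: res_aug_hom.
- move=> x x0; have -> : x = 0; last exact: (linear_fun0 (res_aug_hom J).1).
  by apply: (@res_aug_inj _ _ _ _ I); rewrite x0 (linear_fun0 (res_aug_hom I).1).
(* The invariant says that [res_diff \o f] vanishes on the kernel of the differential of I, hence
   factors through it; the factor is the map in the next degree. *)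
pose P n (f : I n -> J n) := is_rep_hom f /\ forall x, res_diff x = 0 -> res_diff (f x) = 0.
pose R n (f : I n -> J n) (g : I n.+1 -> J n.+1) :=
  forall x, g (res_diff x) = res_diff (f x).
have [||phi phi0 phiP] := @dependent_choice_nat (fun n => I n -> J n) P R f0.
- split=> // x /res_exact0 [w ->]; rewrite f0E; exact: res_diff_aug.
- move=> n f [fh fP].
  have [|||g gh gE] := @injective_rep_factor (J n.+1) (I n) (I n.+1)
    (@res_diff _ _ _ _ I n) (fun x => res_diff (f x)) (@res_injective _ _ _ _ J n.+1).
  + exact: res_diff_hom.
  + by apply: rep_hom_comp; [|exact: res_diff_hom].
  + exact: fP.
  exists g => //; split=> // x /res_exactS [y ->].
  by rewrite gE res_diffK.
exists phi; last by move=> w; rewrite phi0.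
by move=> n; have [[h _] r] := phiP n.
Qed.

(** The map [phi n.+1 - d (h n)] vanishes on the image of the differential, which by exactness is
    the kernel of the next one, so it factors through that one and the factor is [h n.+1]. In degree
    0 the vanishing of [phi 0] on the augmentation takes the place of this. *)
Lemma chain_homotopy_exists I J (phi : forall n, I n -> J n) :
  chain_map phi -> (forall w, phi 0%N (res_aug I w) = 0) ->
  exists h : forall n, I n.+1 -> J n,
    [/\ forall n, is_rep_hom (h n),
        forall x, phi 0%N x = h 0%N (res_diff x)
      & forall n x, phi n.+1 x = res_diff (h n x) + h n.+1 (res_diff x)].
Proof.
move=> phiC phi0.
have [|||h0 h0h h0E] := @injective_rep_factor (J 0%N) (I 0%N) (I 1%N)
    (@res_diff _ _ _ _ I 0%N) (phi 0%N) (@res_injective _ _ _ _ J 0%N).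
- exact: res_diff_hom.
- exact: (phiC 0%N).1.
- by move=> x /res_exact0 [w ->].
pose P n (h : I n.+1 -> J n) := is_rep_hom h /\
  forall x, phi n.+1 (res_diff x) = res_diff (h (res_diff x)).
pose R n (h : I n.+1 -> J n) (h' : I n.+2 -> J n.+1) :=
  forall x, phi n.+1 x = res_diff (h x) + h' (res_diff x).
have [||h hE hP] := @dependent_choice_nat (fun n => I n.+1 -> J n) P R h0.
- by split=> // x; rewrite (phiC 0%N).2 h0E.
- move=> n h [hh hP].
  have qh : is_rep_hom (fun x => phi n.+1 x - res_diff (h x)).
    apply: rep_homB; first exact: (phiC n.+1).1.
    by apply: rep_hom_comp; [|exact: res_diff_hom].
  have [||h' h'h h'E] := @injective_rep_factor (J n.+1) (I n.+1) (I n.+2)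
    (@res_diff _ _ _ _ I n.+1) _ (@res_injective _ _ _ _ J n.+1) _ qh.
  + exact: res_diff_hom.
  + by move=> x /res_exactS [y ->]; rewrite hP subrr.
  exists h'; last by move=> x; rewrite h'E addrC subrK.
  split=> // x; rewrite h'E (linear_funB (res_diff_hom J n.+1).1).
  by rewrite res_diffK subr0 (phiC n.+1).2.
exists h; split=> [n|x|n]; [exact: (hP n).1.1| by rewrite hE h0E | exact: (hP n).2].
Qed.

Lemma coboundaryE I n (f : submod_type (cocycles V I n)) :
  coboundaries V I n f <-> coboundary (val f).
Proof. by []. Qed.

Lemma chain_map_cocycle I J (phi : forall n, I n -> J n) n (f : V -> I n) :
  chain_map phi -> cocycles V I n f -> cocycles V J n (fun v => phi n (f v)).
Proof.
move=> phiC [fh f0]; split; first exact: rep_hom_comp fh (phiC n).1.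
by move=> v; rewrite -(phiC n).2 f0 (linear_fun0 (phiC n.+1).1.1).
Qed.

Lemma chain_map_coboundary I J (phi : forall n, I n -> J n) n (f : V -> I n) :
  chain_map phi -> coboundary f -> coboundary (fun v => phi n (f v)).
Proof.
move=> phiC; case: n f => [|n] f /=.
  by move=> ->; apply/funext => v; rewrite (linear_fun0 (phiC 0%N).1.1).
move=> [g gh ->]; exists (fun v => phi n (g v)).
  exact: rep_hom_comp gh (phiC n).1.
by apply/funext => v; rewrite (phiC n).2.
Qed.

(** The difference of [phi] and the identity lifts zero, so it is null-homotopic; on a cocycle the
    term [h (d f)] of the homotopy formula vanishes. *)
Lemma chain_map_nullhomotopic I (phi : forall n, I n -> I n) n (f : V -> I n) :
  chain_map phi -> (forall w, phi 0%N (res_aug I w) = res_aug I w) ->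
  cocycles V I n f -> coboundary (fun v => phi n (f v) - f v).
Proof.
move=> phiC phi0 [fh f0].
have [|w|h [hh hE hS]] := @chain_homotopy_exists I I (fun n x => phi n x - x).
- move=> m; split; first by apply: rep_homB; [exact: (phiC m).1|exact: rep_hom_id].
  by move=> x; rewrite (phiC m).2 (linear_funB (res_diff_hom I m).1).
- by rewrite phi0 subrr.
case: n f fh f0 => [|n] f fh f0 /=.
  apply/funext => v; rewrite hE f0; exact: (linear_fun0 (hh 0%N).1).
exists (fun v => h n (f v)); first exact: rep_hom_comp fh (hh n).
by apply/funext => v; rewrite hS f0 (linear_fun0 (hh n.+1).1) addr0.
Qed.

(** Chain maps lifting the identity exist in both directions, and both composites are homotopic to
    the identity. *)
Lemma Ext_of_iso I J n : lmod_iso (Ext_of V I n) (Ext_of V J n).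
Proof.
have [phi phiC phi0] := chain_map_exists I J.
have [psi psiC psi0] := chain_map_exists J I.
have compC (I1 I2 : inj_resolution W) (f : forall n, I1 n -> I2 n)
    (g : forall n, I2 n -> I1 n) :
    chain_map f -> chain_map g -> chain_map (fun n x => g n (f n x)).
  move=> fC gC m; split; first exact: rep_hom_comp (fC m).1 (gC m).1.
  by move=> x; rewrite (fC m).2 (gC m).2.
have IC := compC _ _ _ _ phiC psiC; have JC := compC _ _ _ _ psiC phiC.
have I0 w : psi 0%N (phi 0%N (res_aug I w)) = res_aug I w by rewrite phi0 psi0.
have J0 w : phi 0%N (psi 0%N (res_aug J w)) = res_aug J w by rewrite psi0 phi0.
pose Phi (f : submod_type (cocycles V I n)) : submod_type (cocycles V J n) :=
  to_submod (chain_map_cocycle phiC (set_mem (valP f))).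
pose Psi (f : submod_type (cocycles V J n)) : submod_type (cocycles V I n) :=
  to_submod (chain_map_cocycle psiC (set_mem (valP f))).
have Phil : linear Phi.
  move=> a f g; apply: val_inj; apply/funext => v.
  have E (K : inj_resolution W) (x y : submod_type (cocycles V K n)) :
    val (a *: x + y) v = a *: val x v + val y v.
    exact: (congr1 (@^~ v) (submod_valZD a x y)).
  by rewrite E /= -(phiC n).1.1 -E.
pose B := coboundaries V J n.
apply: (@first_isomorphism _ _ _ (fun f => qpi B (Phi f))).
- by move=> a f g; rewrite Phil linearP.
- move=> f; rewrite qpi_eq0; split; last exact: chain_map_coboundary.
  move=> /(chain_map_coboundary psiC) h.
  have h' := chain_map_nullhomotopic IC I0 (set_mem (valP f)).
  (* Here f is the difference of the coboundaries [Psi (Phi f)] and [Psi (Phi f) - f]. *)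
  have := submodB (_ : coboundaries V I n (Psi (Phi f)))
                  (_ : coboundaries V I n (Psi (Phi f) - f)).
  by rewrite subKr; apply.
- move=> q; have [f ->] := qpiP q; exists (Psi f); apply/qpi_eq.
  rewrite -opprB; apply: submodN; apply/coboundaryE.
  exact: (chain_map_nullhomotopic JC J0 (set_mem (valP f))).
Qed.

End Comparison.
End RepHom.

(** * Restriction to an open subgroup, twisted by a character *)

Lemma open_in_subgroup (G : topGroupType) (K L : subgroup G) (A : set G) :
  (forall x, L x -> K x) -> open_in K A -> open_in L A.
Proof.
move=> LK [U oU AU]; exists U => //; apply/seteqP; split=> x [h Lx]; split=> //.
  by have [] : (U `&` subgroup_set K) x by rewrite -AU; split => //; exact: LK.
by have [] : (A `&` subgroup_set K) x by rewrite AU; split => //; exact: LK.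
Qed.

Section TwistedRestriction.
Variables (k : fieldType) (G : topGroupType) (K L : subgroup G).
Hypothesis LK : forall x, L x -> K x.
Variable psi : smoothChar k L.

(** The tensor product with [psi] is realised on the space of V itself, so that resolutions keep
    their spaces and differentials. A homomorphism from the trivial character into it amounts to a
    vector on which L acts by the inverse of [psi]. *)
Definition twist_res (V : smoothRep k K) : smoothRep k L.
Proof.
refine (@SmoothRep k G L V (fun g v => psi g *: ract g v) _ _ _ _).
- move=> g Lg a x y; rewrite (ract_linear (LK Lg)) scalerDr !scalerA.
  by rewrite (mulrC (psi g)).
- by move=> v; rewrite char1 scale1r ract1.
- move=> g h v Lg Lh; have Kg := LK Lg; have Kh := LK Lh.
  by rewrite charM // ractM // (linear_funZ (ract_linear Kg)) scalerA.
- move=> v.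
  have [U [oU U1 UA]] := open_in_nbhs (open_in_subgroup LK (ract_smooth v)) (ract1 v).
  have [U' [oU' U'1 UA']] := open_in_nbhs (char_smooth psi) (char1 psi).
  apply: (@open_in_mulclosed _ _ _ (U `&` U')) => //; first exact: openI.
    by move=> g [[Ug U'g] Lg] /=; rewrite (UA g) ?(UA' g) ?scale1r.
  move=> x y Lx Ly /= hx hy; have Kx := LK Lx; have Ky := LK Ly.
  by rewrite charM // ractM // -scalerA -(linear_funZ (ract_linear Kx)) hy.
Defined.

(** The set is the left coset x L; it contains x, so the default 1 is never taken, and the choice
    depends on the coset only. *)
Definition lrepr (x : G) : G := xget 1%g [set y | L (y^-1 * x)%g].

Lemma lreprP x : L ((lrepr x)^-1 * x)%g.
Proof.
have /(_ _)/xgetPex := ex_intro (fun y => L (y^-1 * x)%g) x.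
by apply; rewrite mulVg; exact: subgroup1.
Qed.

Lemma lreprM x l : L l -> lrepr (x * l)%g = lrepr x.
Proof.
move=> Ll; congr (xget _ _); apply/seteqP; split=> y /=; rewrite mulgA => h.
  by rewrite -(mulgK l (_ * x)%g); apply: subgroupM => //; exact: subgroupV.
exact: subgroupM.
Qed.

(* I is a retract of a space of smooth functions on K, and a linear map into
   the latter extends coset by coset of L. *)
Lemma twist_res_injective (I : smoothRep k K) : open (subgroup_set L) ->
  injective_rep I -> injective_rep (twist_res I).
Proof.
move=> oL Iinj A B i f [il iH] iI [fl fH].
have [rho [rhol rhoH] rhoE] :=
  Iinj _ _ (@embed _ _ _ I) id (embed_hom I) (@embed_inj _ _ _ I) (rep_hom_id I).
pose Phi (a : A) : G -> I := fun x => val (embed (f a : I)) x.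
have Phil : linear Phi.
  move=> c x y; rewrite /Phi fl (embed_hom I).1; apply/funext => g.
  exact: (@Ind_valZD k G triv_group K (forget_rep G I)).
have [Psi Psil PsiE] := linear_extension il iI Phil.
(* The value at x = t l is forced by equivariance: the image of l b must be [psi l] times the right
   translate by l of the image of b, and this is evaluated at t. The linear extension [Psi] is thus
   read only at coset representatives. *)
pose G0 (b : B) (x : G) : I :=
  if `[< K x >] then let t := lrepr x in let l := (t^-1 * x)%g in
    (psi l)^-1 *: Psi (ract l b) t else 0.
have GP b : @Ind_cond k G triv_group K (forget_rep G I) (G0 b).
  split.
  - by move=> x Kx; rewrite /G0 asboolF.
  - by move=> h x -> Kx; rewrite mul1g.
  - have [U [oU U1 UA]] := open_in_nbhs (ract_smooth b) (ract1 b).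
    have [U' [oU' U'1 UA']] := open_in_nbhs (char_smooth psi) (char1 psi).
    (* Intersecting with the open subgroup L ensures that right translation does not change the
       coset representative. *)
    apply: (@open_in_mulclosed _ _ _ (U `&` U' `&` subgroup_set L)).
    + by apply: openI => //; exact: openI.
    + by split; [split|exact: subgroup1].
    + move=> x [[[Ux U'x] Lx] Kx] y Ky; rewrite /G0 !asboolT //; last exact: subgroupM.
      rewrite lreprM // /= mulgA charM //; last exact: lreprP.
      rewrite ractM //; last exact: lreprP.
      by rewrite (UA x) // (UA' x) // mulr1.
    + by move=> x y; exact: right_stabM.
pose g b : inj_env K I := to_submod (S := Ind_submod _ _) (GP b).
have gE b x : K x -> val (g b) x =
    (psi ((lrepr x)^-1 * x)%g)^-1 *: Psi (ract ((lrepr x)^-1 * x)%g b) (lrepr x).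
  by move=> Kx; rewrite /= /G0 asboolT.
have gl : linear g.
  move=> c x y; apply: Ind_eq => z Kz.
  rewrite Ind_valZD !gE // (ract_linear (lreprP z)) Psil.
  by rewrite fctZDE scalerDr !scalerA mulrC.
exists (fun b => rho (g b)).
  split=> [c x y|h v Lh]; first by rewrite gl rhol.
  have Kh := LK Lh.
  rewrite /= -rhoH // -(linear_funZ rhol); congr (rho _).
  apply: Ind_eq => z Kz.
  rewrite -[psi h *: _]addr0 Ind_valZD [val 0 z](_ : _ = 0); last first.
    exact: (congr1 (@^~ z) (submod_val0 _)).
  rewrite addr0 Ind_actE // !gE //; last exact: subgroupM.
  rewrite lreprM // mulgA (charM psi (lreprP z) Lh) (ractM _ (lreprP z) Lh).
  by rewrite scalerA invfM mulrCA divff ?mulr1 // char_neq0.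
move=> x; rewrite -[RHS]rhoE; congr (rho _); apply: Ind_eq => z Kz.
have Ll := lreprP z; set l := (_ * z)%g in Ll.
have Kt : K (lrepr z).
  rewrite -[lrepr z](mulgK l) mulVKg; apply: subgroupM => //.
  by apply: subgroupV; exact: LK.
rewrite gE // -/l -iH // PsiE /Phi fH // !embedE //=.
rewrite (linear_funZ (ract_linear Kt)) scalerA mulVf ?char_neq0 // scale1r.
by rewrite -ractM ?mulVKg //; exact: LK.
Qed.

Lemma twist_res_hom (A B : smoothRep k K) (f : A -> B) :
  is_rep_hom f -> @is_rep_hom k G L (twist_res A) (twist_res B) f.
Proof.
move=> [fl fH]; split=> // h v Lh; have Kh := LK Lh.
by rewrite /= (linear_funZ fl) fH.
Qed.

(** The isomorphism [e] allows for a [W'] that is not literally the twist of W, such as a product of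
    characters. *)
Definition twist_resolution (W : smoothRep k K) (W' : smoothRep k L) (e : W' -> W)
    (I : inj_resolution W) :
  open (subgroup_set L) -> @is_rep_hom k G L W' (twist_res W) e -> bijective e ->
  inj_resolution W'.
Proof.
move=> oL eh eb.
apply: (@InjResolution k G L W' (fun n => twist_res (I n)) (fun v => res_aug I (e v))
  (@res_diff _ _ _ _ I)).
- exact: (rep_hom_comp eh (twist_res_hom (res_aug_hom I))).
- by move=> n; apply: twist_res_hom; exact: res_diff_hom.
- by move=> n; apply: twist_res_injective => //; exact: res_injective.
- by move=> x y /res_aug_inj; exact: (bij_inj eb).
- move=> x; have [e' eK e'K] := eb; rewrite res_exact0.
  by split=> -[v ->]; [exists (e' v); rewrite e'K|exists (e v)].
- by move=> n x; rewrite res_exactS.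
Defined.
End TwistedRestriction.

(** * Functoriality of induction and preservation of injectives *)

Section InductionResolution.
Variables (k : fieldType) (G : topGroupType) (H L : subgroup G).
Hypothesis HL : forall x, H x -> L x.

Fact Ind_map_subproof (A B : smoothRep k H) (f : A -> B) (F : Ind L A) :
  is_rep_hom f -> Ind_cond L (fun x => f (val F x)).
Proof.
move=> [fl fH]; have [F0 FH FL] := set_mem (valP F); split.
- by move=> x Lx; rewrite F0 // (linear_fun0 fl).
- by move=> h x Hh Lx; rewrite FH // fH.
- have [U [oU U1 UA]] := open_in_nbhs FL (@right_stab1 _ _ _ L A (val F)).
  apply: (open_in_mulclosed oU U1) => [x Ux y Ly|x y]; last exact: right_stabM.
  by rewrite (UA x).
Qed.

Definition Ind_map (A B : smoothRep k H) (f : A -> B) (fh : is_rep_hom f)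
    (F : Ind L A) : Ind L B :=
  to_submod (S := Ind_submod L B) (Ind_map_subproof F fh).

Lemma Ind_mapE (A B : smoothRep k H) (f : A -> B) (fh : is_rep_hom f) F x :
  val (Ind_map fh F) x = f (val F x).
Proof. by []. Qed.

Lemma Ind_map_hom (A B : smoothRep k H) (f : A -> B) (fh : is_rep_hom f) :
  is_rep_hom (Ind_map fh).
Proof.
split=> [a x y|h v Lh]; apply: Ind_eq => z Lz.
  by rewrite Ind_valZD !Ind_mapE Ind_valZD fh.1.
by rewrite Ind_actE // !Ind_mapE Ind_actE.
Qed.

(** Frobenius reciprocity: evaluation at 1 turns f into an H-map to I, which extends to some g on B;
    the extension of f then sends b to the function x |-> g (x b). *)
Lemma Ind_injective (I : smoothRep k H) : injective_rep I -> injective_rep (Ind L I).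
Proof.
move=> Iinj A B i f [il iL] iI [fl fL].
(* The twist by the trivial character is plain restriction. *)
pose R (V : smoothRep k L) := twist_res HL (@char_triv k G H) V.
have [|||g [gl gH] gE] := Iinj (R A) (R B) i (fun a => val (f a) 1%g).
- by split=> // h v Hh; rewrite /= !scale1r iL //; exact: HL.
- by [].
- split=> [a x y|h v Hh]; first by rewrite fl Ind_valZD.
  have Lh := HL Hh; rewrite /= scale1r fL // Ind_actE // mul1g.
  have [_ FH _] := set_mem (valP (f v)).
  by rewrite -{1}[h]mulg1 FH //; exact: subgroup1.
have gH' h (v : B) : H h -> g (@ract _ _ _ B h v) = ract h (g v).
  by move=> Hh; have := gH h v Hh; rewrite /= !scale1r.
have GP (b : B) : @Ind_cond k G H L I (fun x => if `[< L x >] then g (@ract _ _ _ B x b) else 0).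
  split.
  - by move=> x Lx; rewrite asboolF.
  - move=> h x Hh Lx; rewrite !asboolT //; last by apply: subgroupM => //; exact: HL.
    by rewrite ractM ?(gH' h) //; exact: HL.
  - have [U [oU U1 UA]] := open_in_nbhs (ract_smooth b) (ract1 b).
    apply: (open_in_mulclosed oU U1) => [x [Ux Lx] y Ly|x y]; last exact: right_stabM.
    by rewrite !asboolT ?ractM ?(UA x) //; exact: subgroupM.
pose g' b : Ind L I := to_submod (S := Ind_submod _ _) (GP b).
have g'E b x : L x -> val (g' b) x = g (@ract _ _ _ B x b) by move=> Lx; rewrite /= asboolT.
exists g'; first split=> [a x y|h v Lh]; last first.
- move=> x; apply: Ind_eq => z Lz.
  by rewrite g'E // -iL // gE fL // Ind_actE // mul1g.
- apply: Ind_eq => z Lz; rewrite Ind_actE // !g'E ?ractM //; exact: subgroupM.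
- by apply: Ind_eq => z Lz; rewrite Ind_valZD !g'E // (ract_linear Lz) gl.
Qed.

End InductionResolution.

(** * Exactness of induction from an open subgroup of finite index *)

Lemma open_big_setI (T : topologicalType) (J : finType) (U : J -> set T) :
  (forall j, open (U j)) -> open (\big[setI/setT]_j U j).
Proof.
move=> oU; apply: (big_ind (fun A : set T => open A)) => //; first exact: openT.
exact: openI.
Qed.

Lemma big_setI_mem (T : Type) (J : finType) (U : J -> set T) x :
  (\big[setI/setT]_j U j) x <-> forall j, U j x.
Proof.
split=> [h j|h]; first by move: h; rewrite (bigD1 j) //= => -[].
by apply: (big_ind (fun A : set T => A x)) => // A B; split.
Qed.

(* The r t represent the left cosets of H, and c x is the index of x H. *)
Definition left_transversal (G : groupType) (H : subgroup G) (T : finType)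
    (r : T -> G) (c : G -> T) : Prop :=
  forall x t, H ((r t)^-1 * x)%g <-> c x = t.

Section Transversal.
Variables (G : groupType) (H : subgroup G) (T : finType) (r : T -> G) (c : G -> T).
Hypothesis rc : left_transversal H r c.

Lemma left_transversalP x : H ((r (c x))^-1 * x)%g.
Proof. exact/rc. Qed.

Lemma left_transversalM x h : H h -> c (x * h)%g = c x.
Proof. by move=> Hh; apply/rc; rewrite mulgA; apply: subgroupM => //; exact: left_transversalP. Qed.

End Transversal.

Section InductionFiniteIndex.
Variables (k : fieldType) (G : topGroupType) (H : subgroup G).
Variables (T : finType) (r : T -> G) (c : G -> T).
Hypotheses (oH : open (subgroup_set H)) (rc : left_transversal H r c).

(** Preimages are chosen at representatives of the finitely many right cosets of H and transported
    by equivariance. Applied to augmentations and differentials, this gives exactness of the induced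
    resolution. *)
Lemma Ind_map_lift (A B : smoothRep k H) (f : A -> B) (fh : is_rep_hom f)
    (F : Ind whole_group B) :
  (forall x, exists a, val F x = f a) -> exists E, F = Ind_map fh E.
Proof.
move=> Fim; pose Y t := projT1 (cid (Fim (r t)^-1%g)).
have YE t : val F (r t)^-1%g = f (Y t) by rewrite /Y; case: cid.
(* The inverses of the [r t] represent the right cosets, and x lies in the one of [(r (d x))^-1]. *)
pose d x := c x^-1%g.
have dP x : H (x * r (d x))%g.
  by have := subgroupV (left_transversalP rc x^-1%g); rewrite invgM !invgK.
have dM h x : H h -> d (h * x)%g = d x.
  by move=> Hh; rewrite /d invgM (left_transversalM rc) //; exact: subgroupV.
have [_ FH _] := set_mem (valP F).
have EP : @Ind_cond k G H whole_group A (fun x => ract (x * r (d x))%g (Y (d x))).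
  split.
  - by move=> x [].
  - by move=> h x Hh _; rewrite dM // -mulgA ractM.
  - pose st t := open_in_nbhs (ract_smooth (Y t)) (ract1 (Y t)).
    pose U t := projT1 (cid (st t)).
    have UP t : [/\ open (U t), U t 1%g & U t `&` subgroup_set H `<=` [set g | ract g (Y t) = Y t]].
      by rewrite /U; case: cid.
    (* If x = h r^-1 with r = [r t], then x g = h (g ^ r) r^-1, so g should be such that g ^ r lies
       in H and fixes [Y t]. As T is finite, the intersection over all t is still open. *)
    pose N t := (fun x => (x ^ r t)%g) @^-1` (U t `&` subgroup_set H).
    apply: (@open_in_mulclosed _ _ _ (\big[setI/setT]_t N t)).
    + apply: open_big_setI => t; apply: open_comp => [x _|].
        exact: conjg_continuous.
      by have [oU _ _] := UP t; exact: openI.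
    + apply/big_setI_mem => t; rewrite /N /= conj1g.
      by have [_ U1 _] := UP t; split=> //; exact: subgroup1.
    + move=> g [/big_setI_mem /(_ (d _)) Ng _] x _.
      have [Ug Hg] := Ng x; have [_ _ /(_ _ (conj Ug Hg)) /= Yg] := UP (d x).
      have xg : (x * g)%g = ((x * r (d x)) * (g ^ r (d x)) * (r (d x))^-1)%g.
        by rewrite conjgE !mulgA mulgK mulgK.
      have dxg : d (x * g)%g = d x.
        apply/rc; rewrite xg -invgM mulgVK; apply: subgroupV.
        by apply: subgroupM.
      by rewrite dxg xg mulgVK ractM // Yg.
    + by move=> x y; exact: right_stabM.
exists (to_submod (S := Ind_submod _ _) EP); apply: Ind_eq => x _ /=.
by rewrite fh.2 // -YE -FH // mulgK.
Qed.

Definition Ind_resolution (W : smoothRep k H) (I : inj_resolution W) :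
  inj_resolution (Ind whole_group W).
Proof.
apply: (@InjResolution k G whole_group (Ind whole_group W)
  (fun n => Ind whole_group (I n)) (Ind_map (res_aug_hom I))
  (fun n => Ind_map (res_diff_hom I n))).
- exact: Ind_map_hom.
- by move=> n; exact: Ind_map_hom.
- by move=> n; apply: Ind_injective => //; exact: res_injective.
- move=> F F' FF'; apply: Ind_eq => x _.
  have := congr1 (fun E : Ind whole_group (I 0%N) => val E x) FF'.
  by rewrite !Ind_mapE => /res_aug_inj.
- move=> F; split=> [dF|[E ->]].
    apply: Ind_map_lift => x; apply/res_exact0.
    by rewrite -(Ind_mapE (res_diff_hom I 0)) dF [LHS](congr1 (@^~ x) (submod_val0 _)).
  apply: Ind_eq => x _; rewrite [RHS](congr1 (@^~ x) (submod_val0 _)) !Ind_mapE.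
  exact: res_diff_aug.
- move=> n F; split=> [dF|[E ->]].
    apply: Ind_map_lift => x; apply/res_exactS.
    by rewrite -(Ind_mapE (res_diff_hom I n.+1)) dF [LHS](congr1 (@^~ x) (submod_val0 _)).
  apply: Ind_eq => x _; rewrite [RHS](congr1 (@^~ x) (submod_val0 _)) !Ind_mapE.
  exact: res_diffK.
Defined.

End InductionFiniteIndex.

(** * Double cosets and sums over left cosets *)

Section DoubleCosets.
Variables (G : groupType) (K H : subgroup G).
Local Open Scope group_scope.

Lemma dcoset_eq g g' : dcoset K H g g' -> dcoset K H g' = dcoset K H g.
Proof.
move=> [x [y [Kx Hy ->]]]; apply/seteqP; split=> _ [x' [y' [Kx' Hy' ->]]].
  by exists (x' * x), (y * y'); split; rewrite ?mulgA //; exact: subgroupM.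
exists (x' * x^-1), (y^-1 * y'); split; rewrite ?mulgA ?mulgVK ?mulgK //.
  by apply: subgroupM => //; exact: subgroupV.
by apply: subgroupM => //; exact: subgroupV.
Qed.

Lemma dcosets_inj (C C' : dcosets K H) : sval C = sval C' -> C = C'.
Proof.
by case: C C' => [C hC] [C' hC'] /= E; subst C'; congr exist; exact: Prop_irrelevance.
Qed.

Lemma dcosets_mem (C : dcosets K H) g : sval C g -> sval C = dcoset K H g.
Proof. by case: C => C [g1 /= ->] /dcoset_eq. Qed.

Variable s : dcosets K H -> G.
Hypothesis hs : forall C, sval C (s C).

Lemma dcosets_repr g : exists z : dcosets K H * (G * G),
  [/\ K z.2.1, H z.2.2 & g = z.2.1 * s z.1 * z.2.2].
Proof.
pose C : dcosets K H := exist _ (dcoset K H g) (ex_intro _ g erefl).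
have [x [y [Kx Hy sE]]] := hs C.
exists (C, (x^-1, y^-1)); split; [exact: subgroupV|exact: subgroupV|].
by rewrite /= sE !mulgA mulVg mul1g mulgK.
Qed.

Lemma dcosets_repr_eq C C' x y x' y' : K x -> H y -> K x' -> H y' ->
  x * s C * y = x' * s C' * y' -> C = C'.
Proof.
move=> Kx Hy Kx' Hy' E.
have mem (D : dcosets K H) z t : K z -> H t -> sval D (z * s D * t).
  by move=> Kz Ht; rewrite (dcosets_mem (hs D)); exists z, t.
apply: dcosets_inj; rewrite (dcosets_mem (mem C x y Kx Hy)) E.
exact/esym/dcosets_mem/mem.
Qed.

(** Every double coset contains some [r t]. Hence every family indexed by double cosets has the
    finite support that [dsum] demands. *)
Lemma dcosets_finite (T : finType) (r : T -> G) (c : G -> T) (A : set (dcosets K H)) :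
  left_transversal H r c -> finite_set A.
Proof.
move=> rc; apply: (sub_finite_set (@subsetT _ A)).
pose C t : dcosets K H := exist _ (dcoset K H (r t)) (ex_intro _ (r t) erefl).
suff -> : [set: dcosets K H] = range C.
  by apply: finite_image; exact: finite_finset.
apply/seteqP; split=> // D _; have [g Dg] := svalP D; exists (c g) => //.
apply: dcosets_inj => /=; rewrite Dg; apply/esym/dcoset_eq.
exists 1, ((r (c g))^-1 * g); split; rewrite ?mul1g ?mulVKg //; first exact: subgroup1.
exact: (left_transversalP rc).
Qed.

(** Left multiplication by g permutes the left cosets of H, and E depends only on the coset. *)
Lemma left_transversal_sum (M : nmodType) (T : finType) (r : T -> G) (c : G -> T)
    (E : G -> M) g : left_transversal H r c ->
  (forall y h, H h -> E (y * h) = E y) ->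
  (\sum_t E (g * r t)%g = \sum_t E (r t))%R.
Proof.
move=> rc EH; have phiI : injective (fun t => c (g * r t)).
  move=> t t' /= E'; have := left_transversalP rc (g * r t'); rewrite -E' => h'.
  have h := left_transversalP rc (g * r t).
  have <- : c (r t') = t'.
    by apply/rc; rewrite mulVg; exact: subgroup1.
  apply/esym/rc.
  have := subgroupM (subgroupV h) h'.
  by rewrite !invgM !invgK !mulgA mulgK mulgVK.
rewrite [RHS](reindex_inj phiI) /=; apply: eq_bigr => t _.
rewrite -{1}[g * r t](mulVKg (r (c (g * r t)))) EH //.
exact: (left_transversalP rc).
Qed.

End DoubleCosets.

Lemma Ind_whole_actE (k : fieldType) (G : topGroupType) (H : subgroup G)
    (sigma : smoothRep k H) (F : Ind whole_group sigma) g x :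
  val (ract g F) x = val F (x * g)%g.
Proof. exact: (@Ind_actE k G H whole_group sigma g F x I). Qed.

(** * Homomorphisms between induced representations, by double cosets *)

Section Mackey.
Variables (k : fieldType) (G : topGroupType) (H K L : subgroup G).
Variables (T : finType) (r : T -> G) (c : G -> T).
Hypotheses (oH : open (subgroup_set H)) (rc : left_transversal H r c).
Variable chi : smoothChar k H.
Variable s : dcosets K H -> G.
Hypotheses (hs : forall C, sval C (s C)).
Hypothesis hL : forall C l, L l <-> K l /\ H (l ^ s C)%g.
Local Notation V := (Ind whole_group (char_rep chi)).

Definition ind_val (v : V) (x : G) : k := val v x.

Lemma ind_valZD a (v v' : V) x : ind_val (a *: v + v') x = a * ind_val v x + ind_val v' x.
Proof. exact: (@Ind_valZD k G H whole_group (char_rep chi)). Qed.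

Lemma ind_val_ract g v x : ind_val (ract g v) x = ind_val v (x * g)%g.
Proof. exact: (Ind_whole_actE v). Qed.

Lemma ind_valM h v x : H h -> ind_val v (h * x)%g = chi h * ind_val v x.
Proof. by move=> Hh; have [_ FH _] := set_mem (valP v); exact: FH. Qed.

Fact ind_delta_subproof :
  @Ind_cond k G H whole_group (char_rep chi) (fun x => if `[< H x >] then chi x else 0).
Proof.
split.
- by move=> x [].
- move=> h x Hh _; case: (pselect (H x)) => Hx.
    by rewrite !asboolT ?charM //; exact: subgroupM.
  rewrite !asboolF /= ?mulr0 // => Hhx; apply: Hx.
  by rewrite -(mulKg h x); apply: subgroupM => //; exact: subgroupV.
- have [U [oU U1 UA]] := open_in_nbhs (char_smooth chi) (char1 chi).
  apply: (@open_in_mulclosed _ _ _ (U `&` subgroup_set H)).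
  + exact: openI.
  + by split=> //; exact: subgroup1.
  + move=> g [[Ug Hg] _] x _; case: (pselect (H x)) => Hx.
      rewrite !asboolT ?charM // ?(UA g) ?mulr1 //.
      exact: subgroupM.
    rewrite !asboolF // => Hxg; apply: Hx.
    by rewrite -(mulgK g x); apply: subgroupM => //; exact: subgroupV.
  + by move=> x y; exact: right_stabM.
Qed.

(** A generator of V under G, by [ind_decomp]; its smoothness rests on H being open. *)
Definition ind_delta : V := to_submod (S := Ind_submod _ _) ind_delta_subproof.

Lemma ind_deltaT x : H x -> ind_val ind_delta x = chi x.
Proof. by move=> Hx; rewrite /ind_val /= asboolT. Qed.

Lemma ind_deltaF x : ~ H x -> ind_val ind_delta x = 0.
Proof. by move=> Hx; rewrite /ind_val /= asboolF. Qed.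

Lemma ract_delta h : H h -> ract h ind_delta = chi h *: ind_delta.
Proof.
move=> Hh; apply: Ind_eq => x _; rewrite -[_ *: _]addr0.
rewrite -[LHS]/(ind_val (ract h ind_delta) x) -[RHS]/(ind_val _ x) ind_valZD ind_val_ract.
rewrite [ind_val 0 x](congr1 (@^~ x) (submod_val0 _)) addr0.
case: (pselect (H x)) => Hx.
  by rewrite !ind_deltaT ?charM 1?mulrC //; exact: subgroupM.
rewrite !ind_deltaF ?mulr0 // => Hxh; apply: Hx.
by rewrite -(mulgK h x); apply: subgroupM => //; exact: subgroupV.
Qed.

(** The translate of [ind_delta] by [r t] is supported on the right coset of [(r t)^-1], so at x
    only the index [c x^-1] contributes. *)
Lemma ind_decomp (v : V) :
  v = \sum_t ind_val v (r t)^-1%g *: (ract (r t) ind_delta : V).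
Proof.
apply: Ind_eq => x _; rewrite -[LHS]/(ind_val v x) -[RHS]/(ind_val _ x).
have el : linear (ind_val^~ x : V -> k^o) by move=> a y z; exact: ind_valZD.
rewrite (linear_fun_sum el) (bigD1 (c x^-1%g)) //= big1 => [|t tc].
  rewrite addr0 (linear_funZ el) ind_val_ract.
  have h := subgroupV (left_transversalP rc x^-1%g); rewrite invgM !invgK in h.
  by rewrite ind_deltaT // /GRing.scale /= mulrC -ind_valM // mulgK.
rewrite (linear_funZ el) ind_val_ract ind_deltaF ?scaler0 // => Hxt.
move/eqP: tc; apply; apply/esym/rc.
by have := subgroupV Hxt; rewrite invgM.
Qed.

Section Target.
Variable J : smoothRep k K.
Local Notation W := (Ind whole_group J).

Definition mackey_inv (C : dcosets K H) : set J :=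
  [set x | forall l, L l -> ract l x = chi (l ^ s C)%g *: x].

Definition mackey_eval (f : V -> W) (C : dcosets K H) : J :=
  val (f (ract (s C) ind_delta)) 1%g.

Lemma hom_delta (f : V -> W) g x : is_rep_hom f ->
  val (f (ract g ind_delta)) x = val (f (ract (x * g)%g ind_delta)) 1%g.
Proof.
by move=> [_ fG]; rewrite ractM // (fG x) // Ind_whole_actE mul1g.
Qed.

(** The factor y is absorbed by [ind_delta], on which H acts by [chi]; the factor x comes out
    because values of f are K-equivariant functions. So g |-> f (g delta) (1) is known on a double
    coset once it is known at one point. *)
Lemma hom_deltaM (f : V -> W) x y g : is_rep_hom f -> K x -> H y ->
  val (f (ract (x * g * y)%g ind_delta)) 1%g =
  chi y *: ract x (val (f (ract g ind_delta)) 1%g).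
Proof.
move=> fh Kx Hy; have [_ FH _] := set_mem (valP (f (ract g ind_delta))).
have gl := ract_linear (s := V) (I : whole_group (x * g)%g).
rewrite ractM // ract_delta // (linear_funZ gl) (linear_funZ fh.1).
rewrite -FH // mulg1 (hom_delta g x fh).
have el : linear (fun v : W => val v 1%g) by move=> a u u'; exact: Ind_valZD.
exact: (linear_funZ el).
Qed.

(** In l s = s (l ^ s), take l out on the left through K, and l ^ s out on the right through H, and
    compare. *)
Lemma mackey_eval_inv (f : V -> W) C : is_rep_hom f -> mackey_inv C (mackey_eval f C).
Proof.
move=> fh l /(hL C) [Kl Hl]; rewrite /mackey_eval.
have H1 := subgroup1 H.
have := hom_deltaM (s C) fh Kl H1; rewrite char1 scale1r mulg1 => <-.
rewrite (conjgC l (s C)).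
have := hom_deltaM (s C) fh (subgroup1 K) Hl.
by rewrite mul1g ract1.
Qed.

Lemma mackey_eval_inj (f : V -> W) : is_rep_hom f ->
  (forall C, mackey_eval f C = 0) -> f = 0.
Proof.
move=> fh f0; have u0 g : val (f (ract g ind_delta)) 1%g = 0.
  have [[C [x y]] /= [Kx Hy ->]] := dcosets_repr hs g.
  by rewrite hom_deltaM // [val _ _]f0 (linear_fun0 (ract_linear Kx)) scaler0.
apply/funext => v; rewrite (ind_decomp v) (linear_fun_sum fh.1) big1 // => t _.
rewrite (linear_funZ fh.1); suff -> : f (ract (r t) ind_delta) = 0 by rewrite scaler0.
by apply: Ind_eq => x _; rewrite hom_delta // u0.
Qed.

Lemma mackey_eval_surj (m : forall C : dcosets K H, J) :
  (forall C, mackey_inv C (m C)) ->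
  exists2 f : V -> W, is_rep_hom f & forall C, mackey_eval f C = m C.
Proof.
move=> mP.
pose dec g := projT1 (cid (dcosets_repr hs g)).
have decP g : [/\ K (dec g).2.1, H (dec g).2.2 & g = (dec g).2.1 * s (dec g).1 * (dec g).2.2]%g.
  by rewrite /dec; case: cid.
pose u g := chi (dec g).2.2 *: ract (dec g).2.1 (m (dec g).1).
(* Independence of the decomposition: two decompositions of one element differ by some l in L, on
   which the eigenvector condition for [m C] makes both values agree. *)
have uE C x y : K x -> H y -> u (x * s C * y)%g = chi y *: ract x (m C).
  move=> Kx Hy; rewrite /u; set g := (x * _ * _)%g.
  have [] := decP g; case: (dec g) => [C' [x' y']] /= Kx' Hy' gE.
  have CC' : C = C' by exact: (dcosets_repr_eq hs Kx Hy Kx' Hy' gE).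
  subst C'; pose l := (x'^-1 * x)%g.
  have lE : (l ^ s C = y' * y^-1)%g.
    rewrite conjgE /l; apply: (mulgI (s C)); rewrite !mulgA mulgV mul1g.
    apply: (mulgI x'); rewrite !mulgA mulgV mul1g.
    by apply: (mulIg y); rewrite mulgVK -gE.
  have Kl : K l by apply: subgroupM => //; exact: subgroupV.
  have Hl : H (l ^ s C)%g by rewrite lE; apply: subgroupM => //; exact: subgroupV.
  have xE : x = (x' * l)%g by rewrite /l mulVKg.
  have Ll : L l by apply/(hL C).
  have Hyy : H (y' * y^-1)%g by rewrite -lE.
  rewrite xE ractM // (mP C l Ll) (linear_funZ (ract_linear Kx')) scalerA lE.
  by rewrite mulrC -charM // mulgVK.
have uM x g y : K x -> H y -> u (x * g * y)%g = chi y *: ract x (u g).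
  move=> Kx Hy; have [[C [x' y']] /= [Kx' Hy' ->]] := dcosets_repr hs g.
  have Kxx := subgroupM Kx Kx'.
  rewrite !mulgA -(mulgA _ y' y) !uE //; last exact: subgroupM.
  by rewrite (linear_funZ (ract_linear Kx)) ractM // charM // scalerA mulrC.
have uH g y : H y -> u (g * y)%g = chi y *: u g.
  by move=> Hy; rewrite -{1}[g]mul1g uM ?ract1 //; exact: subgroup1.
have uK x g : K x -> u (x * g)%g = ract x (u g).
  by move=> Kx; rewrite -[(x * g)%g]mulg1 uM ?char1 ?scale1r //; exact: subgroup1.
(* The formula is dictated by [ind_decomp], since the image of the translate of delta by [r t] has
   to take the value [u (x * r t)] at x. *)
pose f0 (v : V) x : J := \sum_t ind_val v (r t)^-1%g *: u (x * r t)%g.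
have f0G v g x : f0 v (x * g)%g = f0 (ract g v) x.
  (* E is constant on left cosets of H: the factor from v is inverse to the one from u. So the sum
     is unchanged when the transversal is translated by g. *)
  pose E y := ind_val v (y^-1 * g)%g *: u (x * y)%g.
  transitivity (\sum_t E (g * r t)%g).
    by apply: eq_bigr => t _; rewrite /E invgM mulgVK mulgA.
  rewrite (left_transversal_sum g rc) => [|y h Hh]; last first.
    rewrite /E mulgA uH // invgM -mulgA ind_valM; last exact: subgroupV.
    rewrite scalerA mulrC mulrA -charM ?mulgV ?char1 ?mul1r //.
    exact: subgroupV.
  by apply: eq_bigr => t _; rewrite /E ind_val_ract.
have fP v : @Ind_cond k G K whole_group J (f0 v).
  split.
  - by move=> x [].
  - move=> h x Kh _; have hl := ract_linear (s := J) Kh.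
    rewrite /f0 (linear_fun_sum hl); apply: eq_bigr => t _.
    by rewrite (linear_funZ hl) -mulgA uK.
  - have [U [oU U1 UA]] := open_in_nbhs (ract_smooth v) (ract1 v).
    apply: (open_in_mulclosed oU U1) => [g Ug x _|x y]; last exact: right_stabM.
    by rewrite f0G (UA g).
pose f v : W := to_submod (S := Ind_submod _ _) (fP v).
have fE v x : val (f v) x = f0 v x by [].
exists f.
  split=> [a v v'|g v _]; apply: Ind_eq => x _.
    rewrite Ind_valZD !fE /f0 scaler_sumr -big_split; apply: eq_bigr => t _.
    by rewrite ind_valZD scalerDl -scalerA.
  by rewrite Ind_whole_actE !fE f0G.
(* Only the left coset of [s C] meets the support of the translated delta. *)
move=> C; rewrite /mackey_eval fE /f0 (bigD1 (c (s C))) //= big1 => [|t tc].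
  have h := left_transversalP rc (s C); have h' := subgroupV h.
  rewrite addr0 mul1g ind_val_ract ind_deltaT //.
  have -> : u (r (c (s C))) = chi ((r (c (s C)))^-1 * s C)^-1%g *: m C.
    have := uE C _ _ (subgroup1 K) h'.
    by rewrite ract1 mul1g invgM invgK mulgA mulgV mul1g.
  by rewrite scalerA -charM // mulgV char1 scale1r.
rewrite ind_val_ract ind_deltaF ?scale0r // => Hts.
by move/eqP: tc; apply; apply/esym/rc.
Qed.

End Target.
End Mackey.

(** * The Mackey decomposition on complexes and on Ext *)

Section MackeyExt.
Variables (k : fieldType) (G : topGroupType) (H K L : subgroup G).
Variables (T : finType) (r : T -> G) (c : G -> T).
Variables (T' : finType) (r' : T' -> G) (c' : G -> T').
Hypotheses (oH : open (subgroup_set H)) (rc : left_transversal H r c).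
Hypotheses (oK : open (subgroup_set K)) (rc' : left_transversal K r' c').
Hypothesis oL : open (subgroup_set L).
Hypotheses (LK : forall x, L x -> K x) (LH : forall s x, L x -> conj_group s H x).
Hypothesis KHL : forall s x, K x -> H (x ^ s)%g -> L x.
Variables (chi : smoothChar k H) (chi' : smoothChar k K).
Variable s : dcosets K H -> G.
Hypotheses (hs : forall C, sval C (s C)).
Local Notation V := (Ind whole_group (char_rep chi)).
Local Notation psi C := (char_dual (char_res (LH (s C)) (char_conj (s C) chi))).
Local Notation W C := (char_rep (char_mul (char_res LK chi') (psi C))).
Local Notation triv := (char_rep (@char_triv k G L)).

Let hL C l : L l <-> K l /\ H (l ^ s C)%g.
Proof. by split=> [Ll|[]]; [split; [exact: LK|exact: (LH (s C) Ll)]|exact: KHL]. Qed.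

(** The twist by the inverse of chi^s cancels the eigenvalue of x. With [hom_mackey_inv] and
    [triv_homE], maps from the trivial character correspond to such vectors through the image of
    1. *)
Lemma mackey_inv_hom (J : smoothRep k K) C (x : J) : mackey_inv L chi s C x ->
  @is_rep_hom k G L triv (twist_res LK (psi C) J) (fun a => (a : k) *: x).
Proof.
move=> xinv; split=> [a y z|h v Lh]; first by rewrite scalerDl scalerA.
have [Kh Hh] := (hL C h).1 Lh.
rewrite /= mul1r (linear_funZ (ract_linear Kh)) xinv // !scalerA.
by rewrite mulrC mulrA mulfV ?mul1r // char_neq0.
Qed.

Lemma hom_mackey_inv (J : smoothRep k K) C (g : triv -> J) :
  @is_rep_hom k G L triv (twist_res LK (psi C) J) g -> mackey_inv L chi s C (g (1 : k)).
Proof.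
move=> [gl gH] l Ll; have [Kl Hl] := (hL C l).1 Ll.
have gE : g (1 : k) = (chi (l ^ s C)%g)^-1 *: ract l (g (1 : k)).
  by have := gH l (1 : k) Ll; rewrite /= mul1r.
by rewrite [in RHS]gE scalerA mulfV ?scale1r // char_neq0.
Qed.

Lemma triv_homE (J : smoothRep k K) C (g : triv -> J) a :
  @is_rep_hom k G L triv (twist_res LK (psi C) J) g -> g a = (a : k) *: g (1 : k).
Proof.
move=> [gl _]; rewrite -(linear_funZ gl); congr g.
by rewrite /GRing.scale /= mulr1.
Qed.

Fact char_twist_hom C : @is_rep_hom k G L (W C) (twist_res LK (psi C) (char_rep chi')) id.
Proof. by split=> // h v Lh; rewrite /= /GRing.scale /= mulrA [X in X * _]mulrC. Qed.

Variable I : inj_resolution (char_rep chi').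

Definition twisted C : inj_resolution (W C) :=
  twist_resolution (LK := LK) I oL (char_twist_hom C) (Bijective (fun=> erefl) (fun=> erefl)).

Let E := Ind_resolution oK rc' I.
Let ev n (f : V -> Ind whole_group (I n)) C : I n := mackey_eval oH s f C.

Fact ev_cocycle n (f : V -> E n) C : cocycles V E n f ->
  cocycles triv (twisted C) n (fun a => (a : k) *: ev f C).
Proof.
move=> [fh f0]; split.
  apply: mackey_inv_hom; exact: (mackey_eval_inv oH hL C fh).
move=> a; rewrite (linear_funZ (res_diff_hom (twisted C) n).1).
have -> : @res_diff _ _ _ _ (twisted C) n (ev f C) = 0; last by rewrite scaler0.
(* The differential of [E] acts on values of functions, so it commutes with evaluation at 1. *)
have := f0 (ract (s C) (ind_delta oH chi)) => /(congr1 (fun F : E n.+1 => val F 1%g)).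
by [].
Qed.

Lemma ev_linear n a (f g : V -> E n) C : ev (a *: f + g) C = a *: ev f C + ev g C.
Proof. exact: (@Ind_valZD k G K whole_group (I n)). Qed.

Lemma ev_eq n (f g : V -> E n) : is_rep_hom f -> is_rep_hom g ->
  (forall C, ev f C = ev g C) -> f = g.
Proof.
move=> fh gh fg; have h0 : (fun v => f v - g v) = 0.
  apply: (mackey_eval_inj rc hs (rep_homB fh gh)) => C.
  have := ev_linear (-1) g f C; rewrite fg !scaleN1r addNr => <-.
  by rewrite /ev addrC.
by apply/funext => v; apply/eqP; rewrite -subr_eq0; apply/eqP; exact: (congr1 (@^~ v) h0).
Qed.

(** Primitives chosen for each double coset assemble, by [mackey_eval_surj], into one homomorphism;
    its differential has the same components as f, hence equals f by [ev_eq]. *)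
Lemma ev_coboundary n (f : V -> E n) : is_rep_hom f ->
  coboundary (I := E) f <->
  forall C, @coboundary k G L triv (W C) (twisted C) n (fun a : k^o => (a : k) *: ev f C).
Proof.
case: n f => [|n] f fh; split.
- move=> -> C; apply/funext => a; rewrite [ev _ _](_ : _ = 0) ?scaler0 //.
- move=> f0; apply: (mackey_eval_inj rc hs fh) => C.
  by have /(congr1 (@^~ (1 : k))) := f0 C; rewrite scale1r.
- move=> [g gh ->] C; exists (fun a : k^o => (a : k) *: ev g C).
    by apply: mackey_inv_hom; exact: (mackey_eval_inv oH hL C gh).
  apply/funext => a.
  by rewrite [RHS](linear_funZ (res_diff_hom I n).1).
- move=> fB; pose g C := s2val (cid2 (fB C)).
  have gh C : @is_rep_hom k G L triv (twisted C n) (g C) by rewrite /g; case: cid2.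
  have gE C a : (a : k) *: ev f C = res_diff (g C (a : k^o)).
    by rewrite /g; case: cid2 => h _ /= /(congr1 (@^~ a)).
  have [f' f'h f'E] := mackey_eval_surj oH rc hs hL (fun C => hom_mackey_inv (gh C)).
  exists f' => //; apply: ev_eq => // [|C].
    exact: (rep_hom_comp f'h (res_diff_hom E n)).
  by rewrite -[LHS]scale1r gE -[g C _]f'E.
Qed.

Definition ev_map n C (f : submod_type (cocycles V E n)) :
    submod_type (cocycles triv (twisted C) n) :=
  to_submod (ev_cocycle C (set_mem (valP f))).

Lemma ev_mapE n C (f : submod_type (cocycles V E n)) a :
  submod_val (ev_map C f) a = (a : k) *: ev (submod_val f) C.
Proof. by []. Qed.

Lemma ev_map_linear n C : linear (@ev_map n C).
Proof.
move=> a f g; apply: val_inj; apply/funext => b.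
have E1 : submod_val (a *: ev_map C f + ev_map C g) b =
    a *: submod_val (ev_map C f) b + submod_val (ev_map C g) b.
  by rewrite submod_valZD.
apply: etrans (ev_mapE _ _ _) (etrans _ (esym E1)).
by rewrite !ev_mapE submod_valZD ev_linear scalerDr !scalerA [b * a]mulrC.
Qed.

Lemma Ext_of_Ind n : lmod_iso (Ext_of V E n)
  (dsum (fun C => Ext_of triv (twisted C) n)).
Proof.
pose F (f : submod_type (cocycles V E n)) C : Ext_of triv (twisted C) n :=
  qpi (coboundaries triv (twisted C) n) (ev_map C f).
have Ffin f : finite_set [set C | F f C != 0] by exact: dcosets_finite rc.
apply: (@first_isomorphism _ _ _ (fun f => Dsum (Ffin f))).
- move=> a f g; apply: dsum_eq => C; rewrite /= /F ev_map_linear.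
  exact: linearP.
- move=> f; have [fh f0] := set_mem (valP f).
  rewrite /= -[X in _ <-> X]/(coboundary (val f)) ev_coboundary //; split=> [f_eq0 C|fB].
    by have /(congr1 (fun m => m C)) := congr1 (@dsum_fun _ _ _) f_eq0; rewrite /= => /qpi_eq0.
  by apply: dsum_eq => C; apply/qpi_eq0; exact: fB.
- move=> y.
  pose z C := projT1 (cid (qpiP (y C))).
  have zE C : y C = qpi _ (z C) by rewrite /z; case: cid.
  have zh C := set_mem (valP (z C)).
  have [f fh fE] := mackey_eval_surj oH rc hs hL (fun C => hom_mackey_inv (zh C).1).
  (* The differential of f is a homomorphism all of whose components vanish, so it is zero by
     [mackey_eval_inj]. *)
  have fZ : cocycles V E n f.
    split=> // v; pose h := fun u : V => @res_diff _ _ _ _ E n (f u).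
    suff h0 : h = 0 by exact: (congr1 (@^~ v) h0).
    apply: (mackey_eval_inj (oH := oH) rc hs (rep_hom_comp fh (res_diff_hom E n))) => C.
    have := (zh C).2 (1 : k); rewrite -fE.
    by [].
  exists (to_submod fZ); apply: dsum_eq => C; rewrite zE /=; congr (qpi _ _).
  apply: val_inj; apply/funext => a /=.
  by rewrite (triv_homE a (zh C).1) /ev fE.
Qed.
End MackeyExt.

(** The inclusions [LK], [LH] and the converse hypothesis say that L is the intersection of K with
    every conjugate of H, so one group L serves all double cosets. The chosen resolutions are
    exchanged for the induced one on the left and the twisted ones on the right. *)
Theorem Ext_Ind_mackey (k : fieldType) (G : topGroupType) (H K L : subgroup G)
    (T T' : finType) (r : T -> G) (c : G -> T) (r' : T' -> G) (c' : G -> T')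
    (LK : forall x, L x -> K x) (LH : forall s x, L x -> conj_group s H x)
    (chi : smoothChar k H) (chi' : smoothChar k K) (s : dcosets K H -> G) n :
  open (subgroup_set H) -> open (subgroup_set K) -> open (subgroup_set L) ->
  left_transversal H r c -> left_transversal K r' c' ->
  (forall s x, K x -> H (x ^ s)%g -> L x) -> (forall C, sval C (s C)) ->
  lmod_iso (Ext n (Ind whole_group (char_rep chi)) (Ind whole_group (char_rep chi')))
    (dsum (fun C => Ext n (char_rep (@char_triv k G L))
       (char_rep (char_mul (char_res LK chi')
          (char_dual (char_res (LH (s C)) (char_conj (s C) chi))))))).
Proof.
move=> oH oK oL rc rc' KHL hs.
apply: lmod_iso_trans (Ext_of_iso _ _ (Ind_resolution oK rc' (inj_res (char_rep chi'))) n) _.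
apply: lmod_iso_trans (Ext_of_Ind oH rc oK rc' oL LK LH KHL chi hs (inj_res (char_rep chi')) n) _.
by apply: dsum_iso => C; exact: Ext_of_iso.
Qed.

(** * The groups D_a in terms of the valuation of D *)

Section DsubValuation.
Variables (d : nat) (F : fieldType) (v : valuation F) (D : falgType F).
Variables (w : valuation D) (varpi : units w).
Hypothesis hvw : valuation_extends v w.
Hypothesis hvarpi : val_uniformizer w (val varpi).
Hypothesis hvarpid :
  exists2 t : F, val_uniformizer v t & (val varpi) ^+ d = t%:A.
Local Notation U := (units w).

Lemma valuationX (R : idomainType) (u : valuation R) x n :
  x != 0 -> u (x ^+ n) = u x *+ n.
Proof.
move=> x0; elim: n => [|n IH]; first by rewrite expr0 valuation1.
by rewrite exprS valuationM ?expf_neq0 // IH mulrS.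
Qed.

Lemma units_wX (x : U) n : w (val (x ^+ n)%g) = w (val x) *+ n.
Proof.
elim: n => [|n IH]; first by rewrite expg0 /= valuation1.
by rewrite expgS units_wM IH mulrS.
Qed.

Lemma val_expg (x : U) n : val (x ^+ n)%g = val x ^+ n.
Proof. by elim: n => [|n IH]; rewrite ?expg0 // expgS exprS -IH. Qed.

Lemma scalar_neq0 (e : F) : e != 0 -> e%:A != 0 :> D.
Proof. by move=> e0; rewrite scaler_eq0 oner_eq0 orbF. Qed.

Lemma scalarM (e e' : F) : (e * e')%:A = e%:A * e'%:A :> D.
Proof. by rewrite -scalerAl mul1r scalerA. Qed.

Lemma valuation_scalarM (e e' : F) : e != 0 -> e' != 0 ->
  w (e * e')%:A = w e%:A + w e'%:A.
Proof. by move=> e0 e'0; rewrite scalarM valuationM ?scalar_neq0. Qed.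

Lemma valuation_scalarV (e : F) : e != 0 -> w (e^-1)%:A = - w e%:A.
Proof.
move=> e0; apply/eqP; rewrite -addr_eq0 -valuation_scalarM ?invr_neq0 //.
by rewrite mulVf // scale1r valuation1.
Qed.

Lemma val_ring_scalar (e : F) : e != 0 -> 0 <= v e -> 0 <= w e%:A.
Proof.
move=> e0 ve; have [/eqP|//] := (hvw e).1 (or_intror ve).
by rewrite (negbTE (scalar_neq0 e0)).
Qed.

(** Both e and its inverse are integral in F, hence in D. *)
Lemma valuation_scalar0 (e : F) : e != 0 -> v e = 0 -> w e%:A = 0.
Proof.
move=> e0 ve; apply/eqP; rewrite eq_le val_ring_scalar ?ve // andbT.
rewrite -oppr_ge0 -valuation_scalarV // val_ring_scalar ?invr_neq0 //.
have := valuationM v e0 (invr_neq0 e0).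
by rewrite mulfV // valuation1 ve add0r => <-.
Qed.

(** Up to an element of valuation 0, e is a power of t = varpi^d, and w takes the value d at t.
    Negative valuations are reduced to positive ones by inversion. *)
Lemma dvd_valuation_scalar (e : F) : e != 0 -> (d%:Z %| w e%:A)%Z.
Proof.
have pos n e' : e' != 0 -> v e' = n%:Z -> (d%:Z %| w e'%:A)%Z.
  move=> e'0 ve; have [t [t0 vt] tE] := hvarpid.
  have tn0 : t ^+ n != 0 by rewrite expf_neq0.
  have wt m : w (t ^+ m)%:A = d%:Z *+ m.
    elim: m => [|m IH]; first by rewrite expr0 scale1r valuation1.
    rewrite exprS valuation_scalarM ?expf_neq0 // IH mulrS; congr (_ + _).
    by rewrite -tE -val_expg units_wX hvarpi.2 natz.
  have : w (e' / t ^+ n)%:A = 0.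
    apply: valuation_scalar0; first by rewrite mulf_neq0 ?invr_neq0.
    have := valuationM v (mulf_neq0 e'0 (invr_neq0 tn0)) tn0.
    rewrite divfK // valuationX // vt ve natz => /eqP.
    by rewrite -[X in X == _]add0r eq_sym => /eqP/addIr.
  rewrite valuation_scalarM ?invr_neq0 // valuation_scalarV // wt => /eqP.
  by rewrite subr_eq0 => /eqP ->; rewrite -mulr_natr dvdz_mulr.
move=> e0; case vE : (v e) => [n|n]; first exact: pos vE.
rewrite -rpredN -valuation_scalarV //; apply: (@pos n.+1); first by rewrite invr_neq0.
have := valuationM v e0 (invr_neq0 e0); rewrite mulfV // valuation1 vE NegzE.
by move/eqP; rewrite eq_sym addrC subr_eq0 => /eqP.
Qed.

(** Packaged as a subgroup so that it can be put into the definition of [gen_group]. *)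
Definition val_dvd (a : nat) : subgroup U.
Proof.
refine (@Subgroup U [set x | (a%:Z %| w (val x))%Z] _ _ _).
- by rewrite /= valuation1 dvdz0.
- by move=> x y /= hx hy; rewrite units_wM rpredD.
- by move=> x /= hx; rewrite units_wV rpredN.
Defined.

(** Scalars contribute multiples of d, hence of a, and units of O_D contribute 0. Conversely,
    dividing x by the power of varpi^a of the same valuation leaves a unit of O_D. *)
Lemma DsubE a x : (a %| d)%N -> Dsub varpi a x <-> (a%:Z %| w (val x))%Z.
Proof.
move=> ad; split.
  move=> [c [u [z [[e ce] /val_unitsP hu hz ->]]]].
  rewrite !units_wM hu addr0 rpredD //; last first.
    apply: (hz (val_dvd a)) => _ -> /=.
    by rewrite units_wX hvarpi.2 -mulr_natr natz mul1r.
  rewrite ce; apply: (@dvdz_trans d%:Z) => //; apply: dvd_valuation_scalar.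
  by apply: contraTneq (units_neq0 c) => e0; rewrite ce e0 scale0r eqxx.
have main z : gen_group [set (varpi ^+ a)%g] z -> w (val x) = w (val z) -> Dsub varpi a x.
  move=> hz xz; exists 1%g, (x * z^-1)%g, z; split=> //; first exact: subgroup1.
    by apply/val_unitsP; rewrite units_wM units_wV xz subrr.
  by rewrite mul1g mulgVK.
have wn n : w (val ((varpi ^+ a) ^+ n)%g) = n%:Z * a%:Z.
  by rewrite !units_wX hvarpi.2 -mulrnA -[RHS]PoszM natz mulnC.
have gn n : gen_group [set (varpi ^+ a)%g] ((varpi ^+ a) ^+ n)%g.
  elim: n => [|n IH]; first exact: subgroup1.
  by rewrite expgS; apply: subgroupM => // K; apply.
move/dvdzP=> [[n|n] xE].
  by apply: (main ((varpi ^+ a) ^+ n)%g) => //; rewrite wn.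
apply: (main ((varpi ^+ a) ^- n.+1)%g); first by apply: subgroupV; exact: gn.
by rewrite units_wV wn xE NegzE mulNr.
Qed.

Lemma Dsub_open a : (a %| d)%N -> open (subgroup_set (Dsub varpi a)).
Proof.
move=> ad; rewrite openE => x /(DsubE _ ad) ax.
(* On this ball around x the valuation is constant, by the ultrametric inequality. *)
apply: (filterS _ (units_nbhs x (w (val x) + 1))) => y hy; apply/(DsubE _ ad).
suff -> : w (val y) = w (val x) by [].
apply/eqP; rewrite eq_le units_ball_val //=.
have hx : val_ge w (w (val x)) (val x) by right.
have := val_geD hx (val_ge_le (ler_wpDr ler01 (lexx _)) hy); rewrite subrKC.
by case=> // /eqP; rewrite (negbTE (units_neq0 y)).
Qed.

(** By [DsubE] the coset of x is the residue of its valuation modulo a, and varpi has valuation 1.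
    The index type has the form of a successor so that [inord] applies. *)
Lemma Dsub_transversal a : (0 < a)%N -> (a %| d)%N ->
  left_transversal (Dsub varpi a) (fun t : 'I_a.-1.+1 => (varpi ^+ t)%g)
    (fun x => inord `|(w (val x) %% a%:Z)%Z|%N).
Proof.
case: a => // a _ ad x t.
rewrite (DsubE _ ad) units_wM units_wV units_wX hvarpi.2 natz addrC.
have lt : (`|(w (val x) %% a.+1%:Z)%Z| < a.+1)%N.
  by rewrite -ltz_nat gez0_abs ?modz_ge0 // ltz_mod.
rewrite -eqz_mod_dvd; split=> [/eqP E|<-].
  apply: val_inj; rewrite /= inordK // E modz_small //.
  by rewrite ltz_nat ltn_ord.
by rewrite inordK // gez0_abs ?modz_ge0 // modz_mod.
Qed.

End DsubValuation.

Theorem theorem3p2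
  (p d : nat) (F : fieldType) (v : valuation F)
  (D : falgType F) (w : valuation D) (varpi : units w)
  (k : closedFieldType) (iota : {rmorphism 'F_p -> k})
  (hF : nonarch_local_field p v)
  (hd : (1 < d)%N)
  (hD : central_division_algebra d D)
  (hvw : valuation_extends v w)
  (hvarpi : val_uniformizer w (val varpi))
  (hvarpid : exists2 t : F, val_uniformizer v t & (val varpi) ^+ d = t%:A)
  (hp : char_assumption p d v)
  (hk : forall x : k, algebraicOver iota x)
  (a a' : nat) (ha : (a %| d)%N) (ha' : (a' %| d)%N)
  (chi : smoothChar k (Dsub varpi a)) (chi' : smoothChar k (Dsub varpi a'))
  (hpi : irreducible_rep (Ind whole_group (char_rep chi)))
  (hpi' : irreducible_rep (Ind whole_group (char_rep chi')))
  (s : dcosets (Dsub varpi a') (Dsub varpi a) -> units w)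
  (hs : forall C, sval C (s C))
  (n : nat) :
  lmod_iso
    (Ext n (Ind whole_group (char_rep chi)) (Ind whole_group (char_rep chi')))
    (dsum (fun C : dcosets (Dsub varpi a') (Dsub varpi a) =>
       Ext n
         (char_rep (@char_triv k _ (Dsub varpi (lcmn a a'))))
         (char_rep
            (char_mul (char_res (@Dsub_lcmr F D w varpi a a') chi')
               (char_dual
                  (char_res (@Dsub_lcml F D w varpi a a' (s C))
                     (char_conj (s C) chi))))))).
Proof.
have d0 : (0 < d)%N by exact: ltnW.
have dl : (lcmn a a' %| d)%N by rewrite dvdn_lcm ha.
have tr b (bd : (b %| d)%N) := Dsub_transversal hvw hvarpi hvarpid (dvdn_gt0 d0 bd) bd.
have op b (bd : (b %| d)%N) := Dsub_open hvw hvarpi hvarpid bd.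
apply: (@Ext_Ind_mackey _ _ _ _ _ _ _ _ _ _ _ _ (@Dsub_lcml F D w varpi a a') _ _ _ _
  (op a ha) (op a' ha') (op _ dl) (tr a ha) (tr a' ha')) => // g x.
(* Conjugation preserves the valuation, so the two memberships say that a' and a divide the
   valuation of x, that is, their lcm does. *)
move=> /(DsubE hvw hvarpi hvarpid _ ha') Kx /(DsubE hvw hvarpi hvarpid _ ha) Hx.
apply/(DsubE hvw hvarpi hvarpid _ dl); move: Kx Hx.
rewrite conjgE !units_wM units_wV addrCA addNr addr0 !dvdzE /= dvdn_lcm.
by move=> -> ->.
Qed.
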